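(* Let $Z$ be a proper geodesic CAT($-1$) space, $o\in Z$, $\bar X=\partial_\infty Z$ with the visual metric $d_o$, and $X\subset\bar X$ a closed subset. Let $t_0>0$ be a sufficiently large constant and $\Omega=X\times(t_0,\infty)$, with $B_1(\xi,t)$ the closed $d_o$-ball of radius $e^{-t}$ about $\xi$. Let $\mathcal C=\{C_m:m\in\mathbb N\}$ be a countable collection of closed convex subsets of $Z$ with $d_m=d(o,C_m)>t_0$ for all $m$ and with $\{m:d_m\le t\}$ finite for every $t$, of one of the following types: Case 1: $\mathcal C=\mathcal C_1$ consists of pairwise disjoint horoballs $C_m$. Case 2: $\mathcal C=\mathcal C_2$ consists of convex sets $C_m$ with $|\partial_\infty C_m|\ge1$ and is $(2\delta_0,T)$-embedded for some $T\geq 0$. Case 3: $Z=\mathbb H^{n+1}$ is the real hyperbolic space and $\mathcal C=\mathcal C_3=\{x_m\}$ is a collection of $\tau_0$-separated points, for some $\tau_0>0$. Let $\mathcal F_i$ ($i=1,2,3$) be the associated family of resonant sets. Then: (a) In Case 1, and in Case 2 if every $C_m\in\mathcal C_2$ is a geodesic line: if $X$ is $\beta$-diffuse for some $\beta>0$, then $\mathbf{Bad}_X^{B_1}(\mathcal F_i)$ is absolute winning in the sense of McMullen. (b) In Cases 1 and 2: if $(\Omega,B_1)$ is $b_*$-diffuse with respect to $\mathcal C_i^\infty=\{\partial_\infty C_m\}$ for some $b_*>0$, then $\mathbf{Bad}_X^{B_1}(\mathcal F_i)$ is absolute $B_1$-winning with respect to $\mathcal C_i^\infty$ (in particular Schmidt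 winning). (c) In Case 3: if $X$ is the support of a locally finite Borel measure $\mu$ such that $(\Omega,B_1,\mu)$ satisfies a power law with respect to the exponent $\tau>0$, then for every $n_*\in\mathbb N$ and $L_*\ge0$ there is $b_*=b_*(n_*,L_*,\tau,\tau_0)>0$ such that $(\Omega,B_1)$ is $(b_*,n_*,L_* )$-diffuse with respect to $\mathcal F_3$.
   Context: Geometry: $\partial_\infty Y$ is the visual boundary of a convex $Y\subset Z$ (classes of asymptotic rays in $Y$); $(x,y)_o=\frac12(d(o,x)+d(o,y)-d(x,y))$, and for $\xi,\eta\in\partial_\infty Z$, $(\xi,\eta)_o=\lim_{t\to\infty}(\gamma_{o,\xi}(t),\gamma_{o,\eta}(t))_o$ with $\gamma_{o,\xi}$ the unit speed ray from $o$ to $\xi$; $d_o(\xi,\eta)=e^{-(\xi,\eta)_o}$ for $\xi\ne\eta$, $d_o(\xi,\xi)=0$; $(\partial_\infty Z,d_o)$ is a compact metric space. Horoballs are closed sublevel sets of Busemann functions; the boundary of a horoball is its base point. $\delta_0>0$ is a hyperbolicity constant of $Z$: (i) if $p\in[o',x]$, $q\in[o',y]$ with $d(o',p)=d(o',q)\le(x,y)_{o'}$ then $d(p,q)\le\delta_0$ (for $o'\in Z$, $x,y\in Z\cup\partial_\infty Z$), and (ii) in each geodesic triangle with vertices in $Z\cup\partial_\infty Z$ every edge is in the $\delta_0$-neighborhood of the union of the other two. $(2\delta_0,T)$-embedded: $\mathrm{diam}(\mathcal N_{2\delta_0}(C_i)\cap\mathcal N_{2\delta_0}(C_j))\le T$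 for $i\ne j$, where $\mathcal N_\varepsilon$ is the $\varepsilon$-neighborhood. $\tau_0$-separated: distinct points have distance $\ge\tau_0$. In Case 3 write $\partial_\infty C_m:=\{\xi_m^\infty\}$ with $\xi_m^\infty=\gamma_{o,x_m}(\infty)$ the endpoint of the ray from $o$ through $x_m$. Family: $\mathcal F_i$ has index set $\mathbb N$, sizes $s_m=d_m$, resonant sets $R_m=\bigcup\{\partial_\infty C_j: d_j\le d_m\}$. For $Y\subset\bar X$ let $\mathcal N_r(Y)=\bigcup_{y\in Y}\{\eta\in\bar X:d_o(y,\eta)\le r\}$. $\mathbf{Bad}_X^{B_1}(\mathcal F_i)=\{\xi\in X:\exists c\in[0,\infty),\ \xi\notin\bigcup_m\mathcal N_{e^{-(s_m+c)}}(R_m)\}$. $R(t)=\bigcup_{s_m\le t}R_m$, $R(t,b)=R(t)\setminus R(t-b)$. Below, for $\xi\in X$ write $\psi(\xi,t)=B_1(\xi,t)\cap X$. For a collection $\mathcal S$ of subsets of $\bar X$, $(\Omega,B_1)$ is $b_*$-diffuse w.r.t. $\mathcal S$ if for all $(\xi,t)\in\Omega$, $S\in\mathcal S$ there is $\xi'\in X$ with $\psi(\xi',t+b_* )\subset\psi(\xi,t)\setminus\mathcal N_{e^{-(t+b_* )}}(S)$. $X$ is $\beta$-diffuse if this holds with $b_*=\beta$ and $\mathcal S$ the collection of points (singletons) of $\bar X$. $(\Omega,B_1)$ is $(b_*,n_*,L_* )$-diffuse w.r.t. $\mathcal F$ if for all $b>b_*$ there is $n'\in\mathbb N$ such that for all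 $(\xi,t)\in\Omega$ there is $\xi'\in X$ with $\psi(\xi',t+b)\subset\psi(\xi,t)\setminus\mathcal N_{e^{-(t+n'b)}}(R(t,n_*(b+L_* )))$. Power law with exponent $\tau$: there are $c_1,c_2>0$ with $c_1e^{-\tau t}\le\mu(\psi(\xi,t))\le c_2e^{-\tau t}$ for all $(\xi,t)\in\Omega$. Absolute winning: $W\subset X$ is absolute $B_1$-winning w.r.t. $\mathcal S$ if there is $b_0>0$ such that for every $b\ge b_0$ player $A$ has a winning strategy in the following game: $B$ chooses $\omega_1=(x_1,t_1)\in\Omega$; given $\omega_k=(x_k,t_k)$, $A$ chooses $A_k$ either empty or of the form $\mathcal N_{e^{-(t_k+a_k)}}(S_k)\cap X$ with $S_k\in\mathcal S$, $a_k\ge b$, such that the set of legal moves $\{\omega=(x,t_k+\bar b)\in\Omega: b_0\le\bar b\le b,\ \psi(\omega)\subset\psi(\omega_k)\setminus A_k\}$ is nonempty; $B$ chooses $\omega_{k+1}$ among them. $A$ wins if $\bigcap_k\psi(\omega_k)\cap W\ne\emptyset$. Absolute winning in the sense of McMullen means absolute $B_1$-winning w.r.t. the collection of points of $\bar X$. Schmidt winning: there are $a_*\ge0$ and $a>a_*$ such that for every $b>a_*$ player $A$ wins the game in which $B$ chooses $\omega_1=(x_1,t_1)\in\Omega$, then alternately $A$ chooses $\bar\omega_k=(\bar x_k,t_k+a)\in\Omega$ with $\psi(\bar\omega_k)\subset\psi(\omega_k)$ and $B$ chooses $\omega_{k+1}=(x_{k+1},t_k+a+b)\in\Omega$ with $\psi(\omega_{k+1})\subset\psi(\bar\omega_k)$;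 $A$ wins if $\bigcap_k\psi(\omega_k)\cap W\ne\emptyset$. ''$t_0$ sufficiently large'' means: there is a universal constant such that the statement holds whenever $t_0$ is at least this constant.
   Formalization: In (c), b_* is allowed to depend also on the power law constants c_1, c_2 (and on Z, o, δ_0), not only on n_*, L_*, τ, τ_0, because a b_* independent of c_1, c_2 fails for X concentrated in a very small ball. *)

(* Defs.v *)
From HB Require Import structures.
From mathcomp Require Import all_boot all_order all_algebra.
From mathcomp Require Import all_classical all_reals all_analysis.

Set Implicit Arguments.
Unset Strict Implicit.
Unset Printing Implicit Defensive.

Import Order.TTheory GRing.Theory Num.Theory.
Import numFieldNormedType.Exports.

Local Open Scope classical_set_scope.
Local Open Scope ring_scope.

Section DistanceFunction.
Context {R : realType} {T : Type} (dist : T -> T -> R).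

Definition thickening (r : R) (Y : set T) : set T :=
  [set z | exists2 y, Y y & dist y z <= r].

Definition dist_open : set (set T) :=
  [set U | forall x, U x ->
     exists2 e : R, 0 < e & forall y, dist x y < e -> U y].

Definition dist_closed (Y : set T) : Prop := dist_open (~` Y).

End DistanceFunction.

Section Hyperboloid.
Context {R : realType}.

Definition arcosh (x : R) : R := ln (x + Num.sqrt (x ^+ 2 - 1)).

Definition lorentz n (u v : 'rV[R]_n.+1) : R :=
  (\sum_(i < n) u 0 (lift ord0 i) * v 0 (lift ord0 i)) - u 0 0 * v 0 0.

Definition hyperboloid n : set 'rV[R]_n.+1 :=
  [set u | lorentz u u = -1 /\ 0 < u 0 0].

Definition hyp_dist n (u v : 'rV[R]_n.+1) : R := arcosh (- lorentz u v).

End Hyperboloid.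

Section Geometry.
Context {R : realType} {Z : metricType R}.
Local Notation d := (@mdist R Z).

Definition is_segment (x y : Z) (c : R -> Z) : Prop :=
  [/\ c 0 = x, c (d x y) = y &
   forall s t, 0 <= s <= d x y -> 0 <= t <= d x y -> d (c s) (c t) = `|s - t|].

(* The values of a ray at negative times are irrelevant. *)
Definition is_ray (r : R -> Z) : Prop :=
  forall s t, 0 <= s -> 0 <= t -> d (r s) (r t) = `|s - t|.

Definition is_line (c : R -> Z) : Prop :=
  forall s t, d (c s) (c t) = `|s - t|.

Definition geodesic_line (Y : set Z) : Prop := exists2 c, is_line c & Y = range c.

Definition segment (x y : Z) : set Z :=
  [set p | exists2 c, is_segment x y c & exists2 t, 0 <= t <= d x y & c t = p].

Definition geod_convex (Y : set Z) : Prop :=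
  forall x y, Y x -> Y y -> segment x y `<=` Y.

Definition asymptotic (r r' : R -> Z) : Prop :=
  exists K : R, forall t, 0 <= t -> d (r t) (r' t) <= K.

Definition ray_class (r : R -> Z) : set (R -> Z) :=
  [set r' | is_ray r' /\ asymptotic r r'].

End Geometry.

Section Spaces.
Context {R : realType}.

Definition proper_space (Z : metricType R) : Prop :=
  forall (x : Z) (r : R), compact [set y : Z | mdist x y <= r].

Definition geodesic_space (Z : metricType R) : Prop :=
  forall x y : Z, exists c, is_segment x y c.

(* The comparison triangle x', y', z' lies in the hyperbolic plane, and p', q'
   are the comparison points of p on [x, y] and q on [x, z].  By relabelling
   the vertices this covers every pair of sides. *)
Definition cat_minus_one (Z : metricType R) : Prop :=
  geodesic_space Z /\
  forall x y z p q : Z, segment x y p -> segment x z q ->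
  forall x' y' z' p' q' : 'rV[R]_3,
    [/\ hyperboloid x', hyperboloid y', hyperboloid z',
        hyperboloid p' & hyperboloid q'] ->
    [/\ hyp_dist x' y' = mdist x y, hyp_dist x' z' = mdist x z &
        hyp_dist y' z' = mdist y z] ->
    hyp_dist x' p' = mdist x p /\ hyp_dist p' y' = mdist p y ->
    hyp_dist x' q' = mdist x q /\ hyp_dist q' z' = mdist q z ->
    mdist p q <= hyp_dist p' q'.

Definition is_hyperbolic_space (Z : metricType R) (n : nat) : Prop :=
  exists f : Z -> 'rV[R]_n.+1,
    set_bij setT (@hyperboloid R n) f /\
    forall x y, mdist x y = hyp_dist (f x) (f y).

Definition boundary (Z : metricType R) : Type :=
  set_type [set xi : set (R -> Z) | exists2 r, is_ray r & xi = ray_class r].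

HB.instance Definition _ (Z : metricType R) := Choice.on (boundary Z).

(* MathComp-Analysis requires the carrier of a measurable space to be pointed,
   while a boundary may be empty; the base point plays no other role. *)
Definition pboundary (Z : metricType R) (xi0 : boundary Z) : Type := boundary Z.

HB.instance Definition _ (Z : metricType R) (xi0 : boundary Z) :=
  Choice.on (pboundary xi0).
HB.instance Definition _ (Z : metricType R) (xi0 : boundary Z) :=
  isPointed.Build (pboundary xi0) xi0.

End Spaces.

Section Boundary.
Context {R : realType} {Z : metricType R}.
Local Notation d := (@mdist R Z).
Local Notation bdry := (boundary Z).

Definition boundary_of (Y : set Z) : set bdry :=
  [set xi | exists2 r, val xi r & forall t, 0 <= t -> Y (r t)].

(* Endpoints of the rays from o through x: a single point if x <> o and
   geodesics extend uniquely, as in hyperbolic space. *)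
Definition endpoint_through (o x : Z) : set bdry :=
  [set xi | exists2 r, val xi r & r 0 = o /\ r (d o x) = x].

(* The edge between two points of Z or its boundary. *)
Definition geod (x y : Z + bdry) : set Z :=
  match x, y with
  | inl a, inl b => segment a b
  | inl a, inr xi | inr xi, inl a =>
      [set p | exists2 r, val xi r /\ r 0 = a & exists2 t, 0 <= t & r t = p]
  | inr xi, inr eta =>
      [set p | exists2 c, [/\ is_line c, val xi c & val eta (fun t => c (- t))]
                        & exists t, c t = p]
  end.

(* The geodesic from o to x; it stops at x if x is a point of Z. *)
Definition path_to (o : Z) (x : Z + bdry) : R -> Z :=
  match x with
  | inl a => fun t => xget (cst o) [set c | is_segment o a c] (Num.min t (d o a))
  | inr xi => xget (cst o) [set r | val xi r /\ r 0 = o]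
  end.

Definition gromov_prod (o x y : Z) : R := (d o x + d o y - d x y) / 2.

(* Extended real valued, since the product of a boundary point with itself is
   infinite. *)
Definition ext_gromov_prod (o : Z) (x y : Z + bdry) : \bar R :=
  lim ((gromov_prod o (path_to o x t) (path_to o y t))%:E @[t --> +oo]).

Definition dvis (o : Z) (xi eta : bdry) : R :=
  if xi == eta then 0
  else expR (- fine (ext_gromov_prod o (inr xi) (inr eta))).

Definition busemann (r : R -> Z) (z : Z) : R :=
  lim ((d (r t) z - t) @[t --> +oo]).

Definition is_horoball (Y : set Z) : Prop :=
  exists r (s : R), is_ray r /\ Y = [set z | busemann r z <= s].

Definition dist_to (o : Z) (Y : set Z) : R := inf [set d o y | y in Y].

(* The second condition forces the sets to be nonempty when t0 is positive,
   because inf set0 = 0. *)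
Definition admissible (o : Z) (t0 : R) (C : nat -> set Z) : Prop :=
  [/\ forall m, closed (C m) /\ geod_convex (C m),
      forall m, t0 < dist_to o (C m) &
      forall t, finite_set [set m | dist_to o (C m) <= t]].

Definition disjoint_horoballs (C : nat -> set Z) : Prop :=
  (forall m, is_horoball (C m)) /\
  forall i j, i <> j -> C i `&` C j = set0.

Definition embedded (e T : R) (C : nat -> set Z) : Prop :=
  forall i j, i <> j -> forall p q,
    (thickening d e (C i) `&` thickening d e (C j)) p ->
    (thickening d e (C i) `&` thickening d e (C j)) q -> d p q <= T.

Definition embedded_convex_sets (delta0 : R) (C : nat -> set Z) : Prop :=
  (forall m, boundary_of (C m) !=set0) /\
  exists2 T : R, 0 <= T & embedded (2 * delta0) T C.

Definition separated_points (tau0 : R) (x : nat -> Z) : Prop :=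
  forall i j, x i <> x j -> tau0 <= d (x i) (x j).

End Boundary.

Definition hyperbolicity_constant (R : realType) (Z : metricType R) (delta0 : R) :
    Prop :=
  (forall (o : Z) (x y : Z + boundary Z) (p q : Z),
     geod (inl o) x p -> geod (inl o) y q -> mdist o p = mdist o q ->
     ((mdist o p)%:E <= ext_gromov_prod o x y)%E -> mdist p q <= delta0) /\
  forall (x y z : Z + boundary Z),
    geod x y `<=` thickening mdist delta0 (geod x z `|` geod y z).

Record res_family (R : realType) (T : Type) := ResFamily {
  res_size : nat -> R;
  res_set : nat -> set T }.

Definition family_of (R : realType) (T : Type) (dm : nat -> R)
    (bC : nat -> set T) : res_family R T :=
  ResFamily dm (fun m => \bigcup_(j in [set j | dm j <= dm m]) bC j).

Section Games.
Context {R : realType} {T : Type} (dist : T -> T -> R) (X : set T) (t0 : R).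

Definition Omega : set (T * R) := [set w | X w.1 /\ t0 < w.2].

Definition psi (w : T * R) : set T := [set eta | X eta /\ dist w.1 eta <= expR (- w.2)].

Definition res_upto (F : res_family R T) (t : R) : set T :=
  \bigcup_(m in [set m | res_size F m <= t]) res_set F m.

Definition res_window (F : res_family R T) (t b : R) : set T :=
  res_upto F t `\` res_upto F (t - b).

Definition Bad (F : res_family R T) : set T :=
  [set xi | X xi /\ exists2 c : R, 0 <= c &
     ~ (\bigcup_m thickening dist (expR (- (res_size F m + c))) (res_set F m)) xi].

Definition point_sets : set (set T) := range (fun xi : T => [set xi]).

Definition diffuse (b : R) (S : set (set T)) : Prop :=
  forall xi t Y, Omega (xi, t) -> S Y ->
    exists2 xi', X xi' &
      psi (xi', t + b) `<=` psi (xi, t) `\` thickening dist (expR (- (t + b))) Y.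

Definition family_diffuse (bs : R) (ns : nat) (Ls : R) (F : res_family R T) : Prop :=
  forall b, bs < b -> exists n' : nat, forall xi t, Omega (xi, t) ->
    exists2 xi', X xi' &
      psi (xi', t + b) `<=` psi (xi, t) `\`
        thickening dist (expR (- (t + n'%:R * b)))
          (res_window F t (ns%:R * (b + Ls))).

Definition power_law (mu : set T -> \bar R) (c1 c2 tau : R) : Prop :=
  forall xi t, Omega (xi, t) ->
    ((c1 * expR (- (tau * t)))%:E <= mu (psi (xi, t)) <=
     (c2 * expR (- (tau * t)))%:E)%E.

Definition locally_finite (mu : set T -> \bar R) : Prop :=
  forall xi, exists U, [/\ dist_open dist U, U xi & (mu U < +oo)%E].

Definition measure_support (mu : set T -> \bar R) : set T :=
  [set xi | forall U, dist_open dist U -> U xi -> (0 < mu U)%E].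

(* A strategy of player A maps the history w_0, ..., w_k of B's moves to A's next
   move; A's own earlier moves are determined by it.  In each game the first
   clause says that A can always move legally (and, in the absolute game, leaves
   B a legal move) after every finite play in which A follows the strategy. *)
Definition history (w : nat -> T * R) (k : nat) : seq (T * R) := mkseq w k.+1.

Definition abs_legal_A (S : set (set T)) (b : R) (w : T * R) (A : set T) : Prop :=
  A = set0 \/
  exists Y a, [/\ S Y, b <= a & A = thickening dist (expR (- (w.2 + a))) Y `&` X].

Definition abs_legal_B (b0 b : R) (w : T * R) (A : set T) : set (T * R) :=
  [set w' | [/\ Omega w', exists2 b' : R, b0 <= b' <= b & w'.2 = w.2 + b' &
                psi w' `<=` psi w `\` A]].

Definition absolute_winning (S : set (set T)) (W : set T) : Prop :=
  exists2 b0 : R, 0 < b0 & forall b, b0 <= b ->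
  exists sigma : seq (T * R) -> set T,
    let follows (w : nat -> T * R) k :=
      abs_legal_B b0 b (w k) (sigma (history w k)) (w k.+1) in
    (forall w k, Omega (w 0%N) -> (forall i, (i < k)%N -> follows w i) ->
       abs_legal_A S b (w k) (sigma (history w k)) /\
       abs_legal_B b0 b (w k) (sigma (history w k)) !=set0) /\
    (forall w, Omega (w 0%N) -> (forall k, follows w k) ->
       ((\bigcap_k psi (w k)) `&` W) !=set0).

Definition nested_move (s : R) (w w' : T * R) : Prop :=
  [/\ Omega w', w'.2 = w.2 + s & psi w' `<=` psi w].

Definition schmidt_winning (W : set T) : Prop :=
  exists as_ a : R, 0 <= as_ /\ as_ < a /\ forall b, as_ < b ->
  exists sigma : seq (T * R) -> T * R,
    let follows (w : nat -> T * R) k :=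
      nested_move b (sigma (history w k)) (w k.+1) in
    (forall w k, Omega (w 0%N) -> (forall i, (i < k)%N -> follows w i) ->
       nested_move a (w k) (sigma (history w k))) /\
    (forall w, Omega (w 0%N) -> (forall k, follows w k) ->
       ((\bigcap_k psi (w k)) `&` W) !=set0).

End Games.

Definition borel_boundary (R : realType) (Z : metricType R) (o : Z)
    (xi0 : boundary Z) :=
  g_sigma_algebraType (dist_open (dvis o) : set (set (pboundary xi0))).

HB.instance Definition _ (R : realType) (Z : metricType R) (o : Z)
    (xi0 : boundary Z) := Measurable.on (borel_boundary o xi0).

Definition convex_family (R : realType) (Z : metricType R) (o : Z)
    (C : nat -> set Z) : res_family R (boundary Z) :=
  family_of (fun m => dist_to o (C m)) (fun m => boundary_of (C m)).

Definition point_family (R : realType) (Z : metricType R) (o : Z)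
    (x : nat -> Z) : res_family R (boundary Z) :=
  family_of (fun m => dist_to o [set x m]) (fun m => endpoint_through o (x m)).

(* Main.v *)
Require Import Defs.
From mathcomp Require Import all_boot all_order all_algebra.
From mathcomp Require Import all_classical all_reals all_analysis.
From mathcomp Require Import ring lra.

(** For the rays [r], [r'] from [o] to [xi], [eta], the CAT(-1) comparison with
    isosceles hyperbolic triangles gives
      [cosh d(r s, r' u) <= cosh (s - u) + 2 E^2 sinh s sinh u]
    for every [E > d_o(xi, eta)].  Hence nearby boundary points have rays that
    fellow-travel, and [d_o] satisfies the exact triangle inequality, so that the
    balls [psi] are closed and nested plays have a nonempty intersection.

    A ray from [o] to a point of [boundary_of (C m)] stays near [C m] (deep inside
    it for a horoball) from time [dist_to o (C m)] on.  If two sets with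
    [dist_to o (C m) <= t - L] had limit points at distance [O(exp (- t))], the two
    rays would fellow-travel inside both neighbourhoods, against disjointness or
    [T]-embeddedness.  So a ball of radius [exp (- t)] meets at most one active
    obstacle, and player A wins by removing it at every stage.

    In hyperbolic space, the [x j] with [t - w < d o (x j) <= t] whose shadows meet
    a ball of radius [exp (- t)] about [xi] lie within bounded distance of a geodesic
    segment of length [w]; by homogeneity there are [O(w + 1)] of them, while the
    power law needs on the order of [exp (tau b)] balls of radius [exp (- (t + b))]
    to cover the ball. *)

Set Implicit Arguments.
Unset Strict Implicit.
Unset Printing Implicit Defensive.

Import Order.TTheory GRing.Theory Num.Theory.
Import numFieldNormedType.Exports.

Local Open Scope classical_set_scope.
Local Open Scope ring_scope.

(** * Hyperbolic functions built from the exponential *)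

Section HyperbolicFunctions.
Context {R : realType}.
Implicit Types x y : R.

Definition coshR x := (expR x + expR (- x)) / 2.
Definition sinhR x := (expR x - expR (- x)) / 2.

Lemma expRxN x : expR x * expR (- x) = 1.
Proof. by rewrite -expRD subrr expR0. Qed.

Lemma coshR0 : coshR 0 = 1.
Proof. by rewrite /coshR oppr0 expR0; field. Qed.

Lemma sinhR0 : sinhR 0 = 0.
Proof. by rewrite /sinhR oppr0 subrr mul0r. Qed.

Lemma coshRN x : coshR (- x) = coshR x.
Proof. by rewrite /coshR opprK addrC. Qed.

Lemma coshR_norm x : coshR `|x| = coshR x.
Proof. by case: (ger0P x) => // _; rewrite coshRN. Qed.

Lemma sqr_coshR x : coshR x ^+ 2 = 1 + sinhR x ^+ 2.
Proof.
rewrite /coshR /sinhR; have := expRxN x.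
by move: (expR x) (expR (- x)) => a b ab; field: ab.
Qed.

Lemma coshRB x y : coshR (x - y) = coshR x * coshR y - sinhR x * sinhR y.
Proof.
by rewrite /coshR /sinhR opprB !expRD; field.
Qed.

Lemma sinhRB x y : sinhR (x - y) = sinhR x * coshR y - coshR x * sinhR y.
Proof. by rewrite /coshR /sinhR opprB !expRD; field. Qed.

Lemma coshR_half x : coshR x = 1 + 2 * sinhR (x / 2) ^+ 2.
Proof.
have -> : 2 * sinhR (x / 2) ^+ 2 = coshR (x / 2) ^+ 2 + sinhR (x / 2) ^+ 2 - 1.
  by rewrite sqr_coshR; ring.
have -> : coshR x = coshR (x / 2 - (- (x / 2))) by congr coshR; field.
by rewrite coshRB coshRN /sinhR opprK; ring.
Qed.

Lemma coshR_ge1 x : 1 <= coshR x.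
Proof. by rewrite coshR_half lerDl mulr_ge0// sqr_ge0. Qed.

Lemma sinhR_ge0 x : 0 <= x -> 0 <= sinhR x.
Proof.
by move=> x0; rewrite divr_ge0// subr_ge0 ler_expR (le_trans _ x0)// oppr_le0.
Qed.

Lemma sinhR_gt0 x : 0 < x -> 0 < sinhR x.
Proof.
by move=> x0; rewrite divr_gt0// subr_gt0 ltr_expR (lt_trans _ x0)// oppr_lt0.
Qed.

Lemma sinhR_le x : 0 <= x -> sinhR x <= expR x / 2.
Proof. by move=> x0; rewrite ler_pM2r// gerBl expR_ge0. Qed.

Lemma expR_le_coshR x : expR x <= 2 * coshR x.
Proof. by rewrite /coshR mulrCA mulfV// mulr1 lerDl expR_ge0. Qed.

Lemma coshR_lt x y : 0 <= x -> x < y -> coshR x < coshR y.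
Proof.
move=> x0 xy; rewrite -subr_gt0.
(* Both factors are positive, the second one because [0 < x + y]. *)
have -> : coshR y - coshR x = (expR y - expR x) * (1 - expR (- y) * expR (- x)) / 2.
  rewrite /coshR; have := expRxN x; have := expRxN y.
  move: (expR x) (expR (- x)) (expR y) (expR (- y)) => a b c d cd ab.
  by field: ab cd.
have y0 : 0 < y by exact: le_lt_trans xy.
rewrite divr_gt0// mulr_gt0// subr_gt0 ?ltr_expR// -expRD expR_lt1; lra.
Qed.

Lemma coshR_le x y : 0 <= x -> x <= y -> coshR x <= coshR y.
Proof.
by move=> x0; rewrite le_eqVlt => /predU1P[->//|xy]; exact/ltW/coshR_lt.
Qed.

Lemma coshR_leW x y : 0 <= y -> coshR x <= coshR y -> x <= y.
Proof.
move=> y0; apply: contraTT; rewrite -!ltNge => yx; exact: coshR_lt.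
Qed.

Lemma coshR_inj x y : 0 <= x -> 0 <= y -> coshR x = coshR y -> x = y.
Proof.
move=> x0 y0 xy; apply/eqP; rewrite eq_le; apply/andP.
by split; apply: coshR_leW => //; rewrite xy.
Qed.

(** By [coshR_half] it suffices that [sinhR y >= y / 2] for [y >= 0], which follows from
    [expR y >= 1 + y]. This crude bound turns estimates of [coshR] of a distance into estimates of
    the distance itself. *)
Lemma coshR_quadratic x : 0 <= x -> 1 + x ^+ 2 / 8 <= coshR x.
Proof.
move=> x0; rewrite coshR_half lerD2l.
have h : x / 4 <= sinhR (x / 2).
  rewrite /sinhR; have := expR_ge1Dx (x / 2).
  have : expR (- (x / 2)) <= 1 by rewrite expR_le1; lra.
  lra.
have : (x / 4) ^+ 2 <= sinhR (x / 2) ^+ 2 by rewrite ler_sqr ?nnegrE; lra.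
by move=> h2; nra.
Qed.

Lemma arcosh_expP x : 1 <= x -> expR (arcosh x) = x + Num.sqrt (x ^+ 2 - 1).
Proof.
move=> x1; rewrite /arcosh lnK// posrE.
have := sqrtr_ge0 (x ^+ 2 - 1); lra.
Qed.

Lemma coshR_arcosh x : 1 <= x -> coshR (arcosh x) = x.
Proof.
move=> x1; rewrite /coshR expRN arcosh_expP//.
have h0 := sqrtr_ge0 (x ^+ 2 - 1).
have : Num.sqrt (x ^+ 2 - 1) ^+ 2 = x ^+ 2 - 1.
  by rewrite sqr_sqrtr// subr_ge0 -[leLHS](expr1n _ 2) ler_sqr ?nnegrE; lra.
move: (Num.sqrt _) h0 => s s0 ss; field: ss; lra.
Qed.

Lemma arcosh_ge0 x : 1 <= x -> 0 <= arcosh x.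
Proof.
move=> x1; rewrite /arcosh ln_ge0//.
have := sqrtr_ge0 (x ^+ 2 - 1); lra.
Qed.

Lemma coshRK x : 0 <= x -> arcosh (coshR x) = x.
Proof.
move=> x0; apply: coshR_inj => //; first by rewrite arcosh_ge0// coshR_ge1.
by rewrite coshR_arcosh// coshR_ge1.
Qed.

End HyperbolicFunctions.

(** * The Lorentz form and polar coordinates in the hyperbolic plane *)

Section LorentzForm.
Context {R : realType}.

Lemma lorentzC n (u v : 'rV[R]_n.+1) : lorentz u v = lorentz v u.
Proof.
by rewrite /lorentz mulrC; congr (_ - _); apply: eq_bigr => i _; rewrite mulrC.
Qed.

Lemma lorentzDl n (u u' v : 'rV[R]_n.+1) :
  lorentz (u + u') v = lorentz u v + lorentz u' v.
Proof.
rewrite /lorentz !mxE addrACA -opprD -mulrDl -big_split/=.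
by congr (_ - _); apply: eq_bigr => i _; rewrite !mxE mulrDl.
Qed.

Lemma lorentzZl n k (u v : 'rV[R]_n.+1) : lorentz (k *: u) v = k * lorentz u v.
Proof.
rewrite /lorentz !mxE mulrBr mulr_sumr mulrA.
by congr (_ - _); apply: eq_bigr => i _; rewrite !mxE mulrA.
Qed.

Lemma lorentzDr n (v u u' : 'rV[R]_n.+1) :
  lorentz v (u + u') = lorentz v u + lorentz v u'.
Proof. by rewrite lorentzC lorentzDl !(lorentzC v). Qed.

Lemma lorentzZr n k (v u : 'rV[R]_n.+1) : lorentz v (k *: u) = k * lorentz v u.
Proof. by rewrite lorentzC lorentzZl lorentzC. Qed.

Lemma lorentzE n (u : 'rV[R]_n.+1) :
  lorentz u u = \sum_(i < n) u 0 (lift ord0 i) ^+ 2 - u 0 0 ^+ 2.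
Proof. by []. Qed.

(** With [A], [B], [D] as below, the nonnegative sum of [(B * a i - D * b i) ^+ 2] equals
    [B * (A * B - D ^+ 2)]; divide by [B]. If [B = 0], every [b i] vanishes. *)
Lemma sum_CauchySchwarz n (a b : 'I_n -> R) :
  (\sum_i a i * b i) ^+ 2 <= (\sum_i a i ^+ 2) * (\sum_i b i ^+ 2).
Proof.
set A := \sum_i a i ^+ 2; set B := \sum_i b i ^+ 2; set D := \sum_i a i * b i.
have B0 : 0 <= B by apply: sumr_ge0 => i _; exact: sqr_ge0.
have [B_eq0|B_neq0] := eqVneq B 0.
  suff -> : D = 0 by rewrite B_eq0 mulr0 expr2 mulr0.
  apply: big1 => i _.
  have /eqP : b i ^+ 2 = 0.
    by move/psumr_eq0P : B_eq0 => -> // j _; exact: sqr_ge0.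
  by rewrite sqrf_eq0 => /eqP ->; rewrite mulr0.
have : 0 <= \sum_i (B * a i - D * b i) ^+ 2.
  by apply: sumr_ge0 => i _; exact: sqr_ge0.
have -> : \sum_i (B * a i - D * b i) ^+ 2 = B * (A * B - D ^+ 2).
  transitivity (B ^+ 2 * A - 2 * B * D * D + D ^+ 2 * B); last by ring.
  rewrite /A [in RHS]mulr_sumr [X in _ - X]mulr_sumr [X in _ + X]mulr_sumr.
  by rewrite -sumrB -big_split/=; apply: eq_bigr => i _; ring.
by rewrite pmulr_rge0 ?lt_neqAle ?B0 1?eq_sym ?B_neq0// subr_ge0.
Qed.

(** Reverse Cauchy-Schwarz for timelike vectors: with time coordinates [a], [b] and spatial product
    [s], the ordinary inequality reads [s ^+ 2 <= (a ^+ 2 - 1) * (b ^+ 2 - 1)], and the right-hand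
    side is [(a * b - 1) ^+ 2 - (a - b) ^+ 2]. *)
Lemma hyperboloid_lorentz n (u v : 'rV[R]_n.+1) :
  hyperboloid u -> hyperboloid v -> 1 <= - lorentz u v.
Proof.
move=> [uu u0] [vv v0].
have := sum_CauchySchwarz (fun i => u 0 (lift ord0 i)) (fun i => v 0 (lift ord0 i)).
move: uu vv; rewrite !lorentzE /lorentz => uu vv.
have su : \sum_i u 0 (lift ord0 i) ^+ 2 = u 0 0 ^+ 2 - 1 by rewrite -uu; ring.
have sv : \sum_i v 0 (lift ord0 i) ^+ 2 = v 0 0 ^+ 2 - 1 by rewrite -vv; ring.
have : 0 <= u 0 0 ^+ 2 - 1 by rewrite -su sumr_ge0// => i _; exact: sqr_ge0.
have : 0 <= v 0 0 ^+ 2 - 1 by rewrite -sv sumr_ge0// => i _; exact: sqr_ge0.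
rewrite su sv.
set s := \sum_i _; move: (u 0 0) (v 0 0) u0 v0 => a b a0 b0 {uu vv su sv} a1 b1 h.
have ab : 1 <= a * b by nra.
have [|h1] := leP 1 (- (s - a * b)) => //.
have : (a * b - 1) ^+ 2 < s ^+ 2 by rewrite ltr_sqr ?nnegrE; lra.
by have := sqr_ge0 (a - b); nra.
Qed.

Lemma coshR_hyp_dist n (u v : 'rV[R]_n.+1) :
  hyperboloid u -> hyperboloid v -> coshR (hyp_dist u v) = - lorentz u v.
Proof. by move=> hu hv; rewrite /hyp_dist coshR_arcosh// hyperboloid_lorentz. Qed.

(** The form is positive definite on the orthogonal complement of a timelike vector: Cauchy-Schwarz
    on the spatial parts forces the time coordinate of [z] to vanish, and then its spatial part.
    Points of the hyperboloid are identified by their Lorentz products through this lemma. *)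
Lemma lorentz_perp_isotropic n (u z : 'rV[R]_n.+1) :
  hyperboloid u -> lorentz u z = 0 -> lorentz z z = 0 -> z = 0.
Proof.
move=> [uu u0] uz zz.
have := sum_CauchySchwarz (fun i => u 0 (lift ord0 i)) (fun i => z 0 (lift ord0 i)).
move: uu uz zz; rewrite !lorentzE /lorentz => uu uz zz.
have -> : \sum_i u 0 (lift ord0 i) ^+ 2 = u 0 0 ^+ 2 - 1 by rewrite -uu; ring.
have -> : \sum_i u 0 (lift ord0 i) * z 0 (lift ord0 i) = u 0 0 * z 0 0.
  by apply/eqP; rewrite -subr_eq0 uz.
have sz : \sum_i z 0 (lift ord0 i) ^+ 2 = z 0 0 ^+ 2 by apply/eqP; rewrite -subr_eq0 zz.
rewrite sz => h.
have z0 : z 0 0 = 0.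
  by apply/eqP; rewrite -sqrf_eq0 eq_le sqr_ge0 andbT; nra.
apply/rowP => i; rewrite mxE; case: (unliftP ord0 i) => [j|] -> //.
apply/eqP; rewrite -sqrf_eq0; apply/eqP.
move: sz; rewrite z0 expr2 mulr0 => /psumr_eq0P -> // k _; exact: sqr_ge0.
Qed.

Definition row3 (a b c : R) : 'rV[R]_3 := \row_i [:: a; b; c]`_i.

Lemma lorentz_row3 a b c a' b' c' :
  lorentz (row3 a b c) (row3 a' b' c') = b * b' + c * c' - a * a'.
Proof. by rewrite /lorentz !big_ord_recl big_ord0 !mxE/= addr0. Qed.

Lemma hyperboloid_polar s p q : p ^+ 2 + q ^+ 2 = 1 ->
  hyperboloid (row3 (coshR s) (sinhR s * p) (sinhR s * q)).
Proof.
move=> /(canRL (addrK _)) pq; split; last by rewrite mxE/= (lt_le_trans _ (coshR_ge1 s)).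
by rewrite lorentz_row3 -!expr2 sqr_coshR !exprMn pq; ring.
Qed.

(** The hyperbolic law of cosines: for unit directions, [p * p' + q * q'] is the cosine of the angle
    at the apex. *)
Lemma hyp_dist_polar s t p q p' q' :
  hyp_dist (row3 (coshR s) (sinhR s * p) (sinhR s * q))
           (row3 (coshR t) (sinhR t * p') (sinhR t * q')) =
  arcosh (coshR (s - t) + sinhR s * sinhR t * (1 - (p * p' + q * q'))).
Proof. by rewrite /hyp_dist lorentz_row3 coshRB; congr arcosh; ring. Qed.

End LorentzForm.

Lemma expRN_small {R : realType} (e : R) : 0 < e ->
  exists2 T : R, 0 <= T & forall t, T <= t -> expR (- t) <= e.
Proof.
move=> e0; exists e^-1 => [|t et]; first by rewrite invr_ge0 ltW.
rewrite expRN -[leRHS]invrK lef_pV2 ?posrE ?expR_gt0 ?invr_gt0//.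
by apply: (le_trans et); apply: le_trans (expR_ge1Dx t); rewrite lerDr.
Qed.

(** * Geodesic rays and their boundary classes *)

Section Rays.
Context {R : realType} {Z : metricType R}.
Local Notation d := (@mdist R Z).
Local Notation bdry := (boundary Z).
Implicit Types (r c : R -> Z) (x y o : Z) (xi eta : bdry) (s t u v : R).

Lemma ray_dist0 r t : is_ray r -> 0 <= t -> d (r 0) (r t) = t.
Proof. by move=> hr t0; rewrite hr// sub0r normrN ger0_norm. Qed.

Lemma ray_segment r t : is_ray r -> 0 <= t -> is_segment (r 0) (r t) r.
Proof.
move=> hr t0; rewrite /is_segment ray_dist0//; split=> // s u.
by move=> /andP[s0 _] /andP[u0 _]; rewrite hr.
Qed.

Lemma ray_segment_mem r t s : is_ray r -> 0 <= s <= t -> segment (r 0) (r t) (r s).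
Proof.
move=> hr st; have t0 : 0 <= t by case/andP : st => /le_trans; exact.
exists r; first exact: ray_segment.
by exists s => //; rewrite ray_dist0.
Qed.

Lemma segment_dist0 x y c t :
  is_segment x y c -> 0 <= t <= d x y -> d x (c t) = t.
Proof.
move=> [c0 _ hc] tt; rewrite -c0 hc// ?lexx ?mdist_ge0// sub0r normrN ger0_norm//.
by case/andP : tt.
Qed.

Lemma segment_dist1 x y c t :
  is_segment x y c -> 0 <= t <= d x y -> d (c t) y = d x y - t.
Proof.
move=> [_ c1 hc] tt; rewrite -{1}c1 hc// ?lexx ?mdist_ge0// distrC ger0_norm//.
by rewrite subr_ge0; case/andP : tt.
Qed.

Lemma ray_dist_le2 r r' t : is_ray r -> is_ray r' -> r 0 = r' 0 -> 0 <= t ->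
  d (r t) (r' t) <= 2 * t.
Proof.
move=> hr hr' rr' t0; apply: (le_trans (metric_triangle _ (r 0) _)).
by rewrite metric_sym ray_dist0// rr' ray_dist0//; lra.
Qed.

Lemma asymptotic_refl r : asymptotic r r.
Proof. by exists 0 => t _; rewrite mdistxx. Qed.

Lemma asymptotic_sym r r' : asymptotic r r' -> asymptotic r' r.
Proof. by move=> [K hK]; exists K => t t0; rewrite metric_sym hK. Qed.

Lemma asymptotic_trans r r' r'' :
  asymptotic r r' -> asymptotic r' r'' -> asymptotic r r''.
Proof.
move=> [K hK] [K' hK']; exists (K + K') => t t0.
by rewrite (le_trans (metric_triangle _ (r' t) _))// lerD ?hK ?hK'.
Qed.

Lemma bdryP xi : exists2 r, is_ray r & val xi = ray_class r.
Proof. by case: xi => x hx; exact: set_mem hx. Qed.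

Lemma bdry_ray xi r : val xi r -> is_ray r.
Proof. by have [r0 _ ->] := bdryP xi; case. Qed.

Lemma bdry_asymptotic xi r r' : val xi r -> val xi r' -> asymptotic r r'.
Proof.
have [r0 _ ->] := bdryP xi => -[_ h] [_ h'].
exact: asymptotic_trans (asymptotic_sym h) h'.
Qed.

Lemma bdry_mem xi r r' : val xi r -> is_ray r' -> asymptotic r r' -> val xi r'.
Proof.
have [r0 _ ->] := bdryP xi => -[_ h] hr' h'; split => //.
exact: asymptotic_trans h h'.
Qed.

Lemma bdry_inj xi eta r : val xi r -> val eta r -> xi = eta.
Proof.
move=> h h'; apply: val_inj; apply/seteqP; split => r' hr'.
- by apply: bdry_mem h' (bdry_ray hr') (bdry_asymptotic h hr').
- by apply: bdry_mem h (bdry_ray hr') (bdry_asymptotic h' hr').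
Qed.

Lemma ray_bdry r : is_ray r -> exists xi, val xi r.
Proof.
move=> hr; have hS : [set xi : set (R -> Z) | exists2 r, is_ray r & xi = ray_class r]
  (ray_class r) by exists r.
by exists (SigSub (mem_set hS)); split => //; exact: asymptotic_refl.
Qed.

(** * Comparison of two rays with a common origin *)

Section Comparison.
Hypothesis cat : cat_minus_one Z.

(* The comparison triangle is isosceles, with apex [r 0], legs of length [T] and
   apex angle [theta] such that [sin (theta / 2) = k]. *)
Lemma ray_comparison r r' T s u :
  is_ray r -> is_ray r' -> r 0 = r' 0 -> 0 < T -> 0 <= s <= T -> 0 <= u <= T ->
  coshR (d (r s) (r' u)) <=
    coshR (s - u) + 2 * expR (d (r T) (r' T) - 2 * T) * (sinhR s * sinhR u).
Proof.
move=> hr hr' rr' T0 sT uT.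
have cT := ray_dist_le2 hr hr' rr' (ltW T0).
have s0 : 0 <= s by case/andP : sT.
have u0 : 0 <= u by case/andP : uT.
set c := d (r T) (r' T) in cT *; have c0 : 0 <= c by exact: mdist_ge0.
have shT := sinhR_gt0 T0.
pose k := sinhR (c / 2) / sinhR T.
have k0 : 0 <= k by rewrite divr_ge0 ?(ltW shT)// sinhR_ge0// divr_ge0.
have kE : k <= expR (c / 2 - T).
  rewrite ler_pdivrMr// /sinhR mulrA ler_pM2r// mulrBr -!expRD subrK lerD2l lerN2.
  by rewrite ler_expR; lra.
have k1 : k <= 1 by apply: (le_trans kE); rewrite expR_le1; lra.
have kE2 : k ^+ 2 <= expR (c - 2 * T).
  have -> : c - 2 * T = 2 * (c / 2 - T) by field.
  by rewrite expRM_natl ler_sqr ?nnegrE ?expR_ge0.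
(* [p] and [q] are the cosine and the sine of the apex angle. *)
pose p := 1 - 2 * k ^+ 2.
have p2 : p ^+ 2 <= 1.
  have : 0 <= k ^+ 2 <= 1 by rewrite sqr_ge0 expr_le1.
  by rewrite /p; move: (k ^+ 2) => m /andP[m0 m1]; nra.
pose q := Num.sqrt (1 - p ^+ 2).
have pq : p ^+ 2 + q ^+ 2 = 1 by rewrite sqr_sqrtr ?subr_ge0// addrC subrK.
have e1 : (1 : R) ^+ 2 + 0 ^+ 2 = 1 by rewrite expr1n expr0n addr0.
have c1 := coshR_ge1 (s - u).
pose P w a b : 'rV[R]_3 := row3 (coshR w) (sinhR w * a) (sinhR w * b).
have PE w w' a b : a ^+ 2 + b ^+ 2 = 1 -> hyp_dist (P w a b) (P w' a b) = `|w - w'|.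
  move=> ab; rewrite hyp_dist_polar -!expr2 ab subrr mulr0 addr0.
  by rewrite -coshR_norm coshRK.
have hP w a b : a ^+ 2 + b ^+ 2 = 1 -> hyperboloid (P w a b).
  exact: hyperboloid_polar.
(* The apex has radius 0, so it lies on both sides, whichever direction is used to write it. *)
have P0 a b a' b' : P 0 a b = P 0 a' b' by rewrite /P sinhR0 !mul0r.
have key w w' : hyp_dist (P w 1 0) (P w' p q) =
    arcosh (coshR (w - w') + sinhR w * sinhR w' * (2 * k ^+ 2)).
  by rewrite hyp_dist_polar /p; congr (arcosh (_ + _ * _)); ring.
have kc : coshR (T - T) + sinhR T * sinhR T * (2 * k ^+ 2) = coshR c.
  rewrite subrr coshR0 [RHS]coshR_half /k; field; rewrite gt_eqF//.
have T0' := ltW T0.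
have le : d (r s) (r' u) <= hyp_dist (P s 1 0) (P u p q).
  apply: (cat.2 (r 0) (r T) (r' T) _ _ _ _ (P 0 1 0) (P T 1 0) (P T p q)).
  - exact: ray_segment_mem.
  - by rewrite rr'; exact: ray_segment_mem.
  - by split; apply: hP.
  - split; last by rewrite key kc coshRK.
    + by rewrite PE// sub0r normrN ger0_norm// ray_dist0.
    + by rewrite (P0 1 0 p q) PE// sub0r normrN ger0_norm// rr' ray_dist0.
  - by rewrite !PE// sub0r normrN ger0_norm// ray_dist0// hr.
  - rewrite (P0 1 0 p q) !PE// sub0r normrN ger0_norm// rr' ray_dist0// hr'//.
move: le; rewrite key => le.
have X1 : 0 <= sinhR s * sinhR u * (2 * k ^+ 2).
  apply: mulr_ge0; first exact: mulr_ge0 (sinhR_ge0 s0) (sinhR_ge0 u0).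
  exact: mulr_ge0 (sqr_ge0 k).
have : coshR (d (r s) (r' u)) <= coshR (s - u) + sinhR s * sinhR u * (2 * k ^+ 2).
  rewrite -[leRHS]coshR_arcosh; last by rewrite -[leLHS]addr0 lerD.
  by apply: coshR_le => //; exact: mdist_ge0.
move=> /le_trans; apply; rewrite lerD2l [leRHS]mulrC.
apply: ler_wpM2l; first exact: mulr_ge0 (sinhR_ge0 s0) (sinhR_ge0 u0).
by rewrite ler_pM2l.
Qed.

(** Take both times equal to [v] in [ray_comparison]. Since [sinhR v <= expR v / 2], the right-hand
    side is at most [1 + (E * expR v) ^+ 2 / 2] with [E = expR (c / 2 - T)], and [coshR_quadratic]
    bounds the left-hand side from below. *)
Lemma ray_close r r' T v : is_ray r -> is_ray r' -> r 0 = r' 0 -> 0 < T ->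
  0 <= v <= T -> d (r v) (r' v) <= 2 * expR (d (r T) (r' T) / 2 - T + v).
Proof.
move=> hr hr' rr' T0 vT; have v0 : 0 <= v by case/andP : vT.
set c := d (r T) (r' T); set e := d (r v) (r' v).
have e0 : 0 <= e by exact: mdist_ge0.
have := ray_comparison hr hr' rr' T0 vT vT; rewrite -/c -/e subrr coshR0.
have -> : c - 2 * T = 2 * (c / 2 - T) by field.
rewrite expRD expRM_natl; set E := expR (c / 2 - T) => h1.
have h2 := coshR_quadratic e0.
have h3 := sinhR_ge0 v0; have h4 := sinhR_le v0.
have E0 : 0 <= E by exact: expR_ge0.
have h5 : (sinhR v * 2) ^+ 2 <= expR v ^+ 2.
  by rewrite ler_sqr ?nnegrE; [lra|lra|exact: expR_ge0].
have h6 : e ^+ 2 <= (2 * (E * expR v)) ^+ 2.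
  have := ler_wpM2l (sqr_ge0 E) h5; move: h1 h2 {h3 h4 h5}.
  move: (coshR e) (sinhR v) (expR v) => a b f h1 h2.
  rewrite !exprMn => h5; lra.
by move: h6; rewrite ler_sqr ?nnegrE// !mulr_ge0 ?expR_ge0.
Qed.

(* The last hypothesis says that the Gromov products of [r T] and [r' T] based at
   the origin are unbounded. *)
Lemma rays_meet r r' : is_ray r -> is_ray r' -> r 0 = r' 0 ->
  (forall M, exists2 T, M <= T & d (r T) (r' T) / 2 - T <= - M) ->
  forall t, 0 <= t -> r t = r' t.
Proof.
move=> hr hr' rr' hM t t0; apply: mdist_positivity.
apply/eqP; rewrite eq_le mdist_ge0 andbT.
apply/ler_addgt0Pl => e e0; rewrite addr0.
have e20 : 0 < e / 2 by rewrite divr_gt0.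
have [T T0 hT] := expRN_small e20.
have [T' TT' h] := hM (t + T + 1).
have T'0 : 0 < T' by rewrite (lt_le_trans _ TT')// ltr_wpDl// addr_ge0.
have tT' : 0 <= t <= T'.
  by rewrite t0 (le_trans _ TT')// -addrA lerDl addr_ge0.
apply: (le_trans (ray_close hr hr' rr' T'0 tT')).
rewrite mulrC -ler_pdivlMr//; apply: le_trans (hT T (lexx _)).
rewrite ler_expR; move: h; set x := _ / 2 => h; lra.
Qed.

(** If the rays stay within [K], the Gromov product of [r T] and [r' T] is at least [T - K / 2],
    hence unbounded, and [rays_meet] applies. *)
Lemma ray_unique r r' : is_ray r -> is_ray r' -> r 0 = r' 0 -> asymptotic r r' ->
  forall t, 0 <= t -> r t = r' t.
Proof.
move=> hr hr' rr' [K hK]; apply: rays_meet => // M.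
pose T := Num.max 0 (M + K / 2) + `|M|.
have T0 : 0 <= T by rewrite addr_ge0// le_max lexx.
exists T.
  have := ler_norm M; have : 0 <= Num.max 0 (M + K / 2) by rewrite le_max lexx.
  rewrite /T; lra.
have T1 : M + K / 2 <= T.
  by rewrite /T -[leLHS]addr0 lerD// le_max lexx orbT.
have := hK _ T0; set x := d _ _; lra.
Qed.

End Comparison.

(** * Limits of geodesics in a proper space *)

Section Limits.
Hypothesis proper : proper_space Z.

(* The limit is taken along an ultrafilter on the indices, so that it exists for all
   times simultaneously. *)
Lemma ray_limit (c : nat -> R -> Z) o :
  (forall n, c n 0 = o) ->
  (forall t, 0 <= t -> exists N, forall n, (N <= n)%N ->
     forall s u, 0 <= s <= t -> 0 <= u <= t -> d (c n s) (c n u) = `|s - u|) ->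
  exists g, [/\ is_ray g, g 0 = o &
    forall t e, 0 <= t -> 0 < e -> forall N, exists2 n, (N <= n)%N & d (c n t) (g t) < e].
Proof.
move=> c0 hc; have [U [UU ooU]] := ultraFilterLemma (eventually_filter).
have tail N : U [set n | (N <= n)%N] by apply: ooU; exists N.
have lim t : exists p, 0 <= t -> forall e, 0 < e -> U [set n | d (c n t) p < e].
  have [t0|t0] := boolP (0 <= t); last by exists o.
  have [N hN] := hc t t0.
  (* For large [n] the points [c n t] lie in a fixed closed ball, which is compact, so they cluster
     along [U]. *)
  have FB : U [set n | d o (c n t) <= t].
    apply: filterS (tail N) => n /= Nn.
    by rewrite -(c0 n) hN// ?lexx ?t0// sub0r normrN ger0_norm.
  have [p [_ clp]] := @proper o t ((c ^~ t) @ U) _ FB.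
  (* An ultrafilter contains each set or its complement, so a cluster point along [U] is a limit
     along [U]. *)
  exists p => _ e e0; have [//|Uc] := in_ultra_setVsetC [set n | d (c n t) p < e] UU.
  have [z [/= zp]] := clp (~` [set y | d y p < e]) (ball p e) Uc (nbhsx_ballx _ _ e0).
  by rewrite ballEmdist/= metric_sym => /zp.
have [g hg] := choice lim.
have near t e N : 0 <= t -> 0 < e -> U [set n | (N <= n)%N /\ d (c n t) (g t) < e].
  by move=> t0 e0; apply: filterI; [exact: tail|exact: hg].
exists g; split.
- move=> s t s0 t0; have [N hN] := hc (s + t) (addr_ge0 s0 t0).
  suff h e : 0 < e -> `| d (g s) (g t) - `|s - t| | <= e.
    apply/eqP; rewrite -subr_eq0 -normr_eq0 eq_le normr_ge0 andbT.
    by apply/ler_addgt0Pl => e e0; rewrite addr0 h.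
  move=> e0; have e20 : 0 < e / 2 by rewrite divr_gt0.
  (* A single index serves both times, so the isometry equation of [c n] passes to [g] up to [e]. *)
  have [n [[Nn ns] [_ nt]]] := filter_ex (filterI (near s _ N s0 e20) (near t _ N t0 e20)).
  rewrite -(hN n Nn s t); [|by rewrite s0 lerDl|by rewrite t0 lerDr].
  have := metric_triangle (g s) (c n s) (g t).
  have := metric_triangle (c n s) (c n t) (g t).
  have := metric_triangle (c n s) (g s) (c n t).
  have := metric_triangle (g s) (g t) (c n t).
  rewrite (metric_sym (g s) (c n s)) (metric_sym (g t) (c n t)).
  move: ns nt; set x := d _ _; set y := d _ _; set z := d _ _; set w := d _ _.
  move: (d (g s) (c n t)) (d (c n s) (g t)) => a b *.
  by rewrite ler_norml; apply/andP; split; lra.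
- apply: mdist_positivity; apply/eqP; rewrite eq_le mdist_ge0 andbT.
  apply/ler_addgt0Pl => e e0; rewrite addr0 metric_sym.
  by have [n [_ /=]] := filter_ex (near 0 e 0%N (lexx _) e0); rewrite c0 => /ltW.
- move=> t e t0 e0 N; have [n [Nn h]] := filter_ex (near t e N t0 e0).
  by exists n.
Qed.

End Limits.
End Rays.

(** * Fellow travelling, and the visual metric as a decreasing limit *)

Section FellowTravelling.
Context {R : realType} {Z : metricType R}.
Local Notation d := (@mdist R Z).
Local Notation bdry := (boundary Z).
Implicit Types (r c : R -> Z) (x y o : Z) (xi eta : bdry) (s t u v : R).
Variable delta0 : R.
Hypothesis cat : cat_minus_one Z.
Let geodesic : geodesic_space Z := cat.1.
Hypothesis hyp : hyperbolicity_constant Z delta0.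

Lemma gromov_prod_le o x y : gromov_prod o x y <= d o x /\ gromov_prod o x y <= d o y.
Proof.
have := metric_triangle o x y; have := metric_triangle o y x.
rewrite /gromov_prod (metric_sym y x).
by move: (d o x) (d o y) (d x y) => a b c h1 h2; split; lra.
Qed.

Lemma path_to_end o x t : d o x <= t -> path_to o (inl x) t = x.
Proof.
move=> xt; rewrite /path_to min_r//.
by have [_ -> _] := xgetPex (cst o) (geodesic o x).
Qed.

Lemma ext_gromov_prod_inl o x y :
  ext_gromov_prod o (inl x) (inl y) = (gromov_prod o x y)%:E.
Proof.
apply: lim_near_cst => //; near=> t.
by rewrite !path_to_end//; near: t; apply: nbhs_pinfty_ge; rewrite num_real.
Unshelve. all: by end_near. Qed.

(** The first clause of [hyperbolicity_constant] for two points of [Z], whose extended Gromov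
    product is the ordinary one. *)
Lemma fellow_travel o x y c c' t : is_segment o x c -> is_segment o y c' ->
  0 <= t <= gromov_prod o x y -> d (c t) (c' t) <= delta0.
Proof.
move=> hc hc' /andP[t0 tg].
have [gx gy] := gromov_prod_le o x y.
have tx : 0 <= t <= d o x by rewrite t0 (le_trans tg).
have ty : 0 <= t <= d o y by rewrite t0 (le_trans tg).
apply: (hyp.1 o (inl x) (inl y)) => /=.
- by exists c => //; exists t.
- by exists c' => //; exists t.
- by rewrite (segment_dist0 hc)// (segment_dist0 hc').
- by rewrite ext_gromov_prod_inl (segment_dist0 hc)// lee_fin.
Qed.

Lemma ray_gromov_prod r o n m : is_ray r -> 0 <= n -> 0 <= m ->
  Num.min n m - d o (r 0) <= gromov_prod o (r n) (r m).
Proof.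
move=> hr n0 m0; rewrite /gromov_prod hr//.
have := metric_triangle (r 0) o (r n); have := metric_triangle (r 0) o (r m).
rewrite !ray_dist0// (metric_sym (r 0) o).
move: (d o (r 0)) (d o (r n)) (d o (r m)) => a b c h1 h2.
by case: (leP n m) => nm; [rewrite ler0_norm|rewrite gtr0_norm]; lra.
Qed.

Hypothesis proper : proper_space Z.

(** Far points of one ray have a large Gromov product seen from [o], so the segments from [o] to
    them share long initial pieces up to [delta0]. *)
Lemma segments_to_ray r o K (c : nat -> R -> Z) (n m : nat) t : is_ray r ->
  d o (r 0) <= K -> (forall n, is_segment o (r n%:R) (c n)) -> 0 <= t ->
  t + K <= n%:R -> t + K <= m%:R -> d (c n t) (c m t) <= delta0.
Proof.
move=> hr oK hc t0 tn tm; apply: (fellow_travel (hc n) (hc m)).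
rewrite t0/=; apply: le_trans (ray_gromov_prod _ hr (ler0n _ n) (ler0n _ m)).
rewrite lerBrDr le_min !(le_trans _ tn) ?(le_trans _ tm)// lerD2l//.
Qed.

Lemma closed_limit (C : set Z) p : closed C ->
  (forall e, 0 < e -> exists2 q, C q & d q p < e) -> C p.
Proof.
move=> cC h; apply: cC => B /nbhs_ballP [e /= e0 eB].
have [q Cq qp] := h e e0; exists q; split => //; apply: eB.
by rewrite ballEmdist/= metric_sym.
Qed.

(** The ray [g] is a limit of the segments from [o] to [r n]: convexity keeps these segments in [C],
    and closedness keeps the limit there. *)
Lemma ray_from_convex (C : set Z) o xi r : closed C -> geod_convex C -> C o ->
  val xi r -> (forall t, 0 <= t -> C (r t)) ->
  exists g, [/\ val xi g, g 0 = o & forall t, 0 <= t -> C (g t)].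
Proof.
move=> cC gC Co xir Cr; have hr := bdry_ray xir.
set K := d o (r 0); have K0 : 0 <= K := mdist_ge0 _ _.
have [c hc] := choice (fun n : nat => geodesic o (r n%:R)).
have long n : n%:R - K <= d o (r n%:R) <= n%:R + K.
  have := metric_triangle (r 0) o (r n%:R); have := metric_triangle o (r 0) (r n%:R).
  by rewrite !ray_dist0// (metric_sym (r 0) o) -/K; lra.
have in_dom n t : 0 <= t -> t + K <= n%:R -> 0 <= t <= d o (r n%:R).
  by move=> t0 tn; have := long n; rewrite t0/=; lra.
have nat_ge (t : R) : exists N : nat, forall n, (N <= n)%N -> t <= n%:R.
  exists (Num.trunc `|t|).+1 => n Nn; rewrite (le_trans (ler_norm t))//.
  by rewrite (le_trans (ltW (truncnS_gt `|t|)))// ler_nat.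
have [g [hg g0 glim]] : exists g, [/\ is_ray g, g 0 = o &
    forall t e, 0 <= t -> 0 < e -> forall N, exists2 n, (N <= n)%N & d (c n t) (g t) < e].
  apply: ray_limit => // [n|t t0]; first by have [] := hc n.
  have [N hN] := nat_ge (t + K); exists N => n Nn s u /andP[s0 st] /andP[u0 ut].
  have [_ _ ->//] := hc n; apply: in_dom => //; have := hN n Nn; lra.
exists g; split => // [|t t0].
(* The chain [r t], [r m], [c m t], [c n t], [g t], with [m] the first integer above [t + K], has
   links at most [K + 1], [2 * K + 1], [delta0] and 1. *)
- apply: bdry_mem xir hg _; exists (delta0 + 3 + 3 * K) => t t0.
  have [N hN] := nat_ge (t + K).
  have [n /hN tn nt] := glim t 1 t0 ltr01 N.
  pose m := (Num.trunc (t + K)).+1.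
  have tK : 0 <= t + K by exact: addr_ge0.
  have tm : t + K <= m%:R by exact/ltW/truncnS_gt.
  have mt : m%:R <= t + K + 1 by rewrite -natr1 lerD2r truncn_le.
  have h1 : d (c n t) (c m t) <= delta0 by exact: (segments_to_ray hr (lexx _) hc).
  have h2 := segment_dist1 (hc m) (in_dom _ _ t0 tm).
  have h3 : d (r m%:R) (r t) <= K + 1 by rewrite hr// ger0_norm; lra.
  have := long m; have := metric_triangle (r t) (r m%:R) (g t).
  have := metric_triangle (r m%:R) (c m t) (g t).
  have := metric_triangle (c m t) (c n t) (g t).
  rewrite (metric_sym (r t) (r m%:R)) (metric_sym (r m%:R) (c m t)) (metric_sym (c m t) (c n t)).
  rewrite h2; move: h1 h3 nt.
  by move: (d _ _) (d _ _) (d _ _) (d _ _) (d _ _) (d _ _) (d _ _) => *; lra.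
- apply: closed_limit => // e e0; have [N hN] := nat_ge (t + K).
  have [n /hN tn nt] := glim t e t0 e0 N.
  exists (c n t) => //; apply: (gC _ _ Co (Cr _ (ler0n _ n))).
  by exists (c n) => //; exists t => //; exact: in_dom.
Qed.

Lemma ray_from o xi : exists2 g, val xi g & g 0 = o.
Proof.
have [r hr xiE] := bdryP xi.
have xir : val xi r by rewrite xiE; split => //; exact: asymptotic_refl.
have [||//|g [? ? _]] := @ray_from_convex setT o xi r closedT _ _ xir _ => //.
by exists g.
Qed.

(** By uniqueness of the ray from [o] to [xi], the choice made by [xget] is harmless. *)
Lemma path_to_ray o xi r t : val xi r -> r 0 = o -> 0 <= t -> path_to o (inr xi) t = r t.
Proof.
move=> xir r0; rewrite /path_to.
have [|xip p0] := @xgetPex _ (cst o) [set r | val xi r /\ r 0 = o].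
  by have [g] := ray_from o xi; exists g.
move: xip p0; set p := xget _ _ => xip p0.
apply: ray_unique => //; [exact: bdry_ray xip|exact: bdry_ray xir|by rewrite p0|].
exact: bdry_asymptotic xip xir.
Qed.

(* [visE r r' t] is [exp (- (r t, r' t)_o)] for rays from [o]. *)
Definition visE r r' t : R := expR (d (r t) (r' t) / 2 - t).

Lemma visE_nonincreasing r r' s t : is_ray r -> is_ray r' -> 0 <= s -> s <= t ->
  visE r r' t <= visE r r' s.
Proof.
move=> hr hr' s0 st; rewrite ler_expR.
have := metric_triangle (r t) (r s) (r' t); have := metric_triangle (r s) (r' s) (r' t).
have t0 := le_trans s0 st.
rewrite hr// hr'// (distrC s t) ger0_norm ?subr_ge0//.
by move: (d _ _) (d _ _) (d _ _) => *; lra.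
Qed.

(** Replaces the limit of extended reals in [dvis] by two usable facts: the nonincreasing function
    [visE r r'] stays above [dvis o xi eta] and converges to it. *)
Lemma visE_limit o xi eta r r' : val xi r -> val eta r' -> r 0 = o -> r' 0 = o ->
  (forall t, 0 <= t -> dvis o xi eta <= visE r r' t) /\
  (forall e, dvis o xi eta < e -> exists2 T, 0 <= T & forall t, T <= t -> visE r r' t < e).
Proof.
move=> xir etar r0 r'0; have hr := bdry_ray xir; have hr' := bdry_ray etar.
suff h : (forall t, 0 <= t -> dvis o xi eta <= visE r r' t) /\
  (forall e, dvis o xi eta < e -> exists2 T, 0 <= T & visE r r' T < e).
  split; first exact: h.1; move=> e /h.2 [T T0 hT]; exists T => // t Tt.
  by apply: le_lt_trans hT; exact: visE_nonincreasing.
rewrite /dvis; case: eqVneq => [xe|xe].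
  have rr' t : 0 <= t -> r t = r' t.
    apply: ray_unique => //; first by rewrite r0.
    by apply: bdry_asymptotic etar; rewrite -xe.
  split => [t t0|e e0]; first exact: expR_ge0.
  have e20 : 0 < e / 2 by rewrite divr_gt0.
  have [T T0 hT] := expRN_small e20; exists T => //.
  rewrite /visE rr'// mdistxx mul0r sub0r (le_lt_trans (hT _ (lexx _)))//; lra.
pose g t := t - d (r t) (r' t) / 2.
have visEg t : visE r r' t = expR (- g t) by rewrite /visE /g opprB.
have gE t : 0 <= t -> gromov_prod o (path_to o (inr xi) t) (path_to o (inr eta) t) = g t.
  move=> t0; rewrite !(path_to_ray xir, path_to_ray etar)// /gromov_prod.
  by rewrite -{1}r0 -r'0 !ray_dist0// /g; field.
have g_mono s t : 0 <= s -> s <= t -> g s <= g t.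
  by move=> s0 st; rewrite -lerN2 -ler_expR -!visEg visE_nonincreasing.
(* Freezing [g] at negative times makes it monotone on the whole line. *)
pose g' t := g (Num.max 0 t).
have ndg : {homo g' : s t / s <= t}.
  by move=> s t st; apply: g_mono; [rewrite le_max lexx|rewrite ge_max]; rewrite ?le_max ?lexx ?st ?orbT.
(* Unbounded Gromov products would make the rays coincide by [rays_meet], against [xi != eta]. *)
have [M hM] : exists M, forall t, 0 <= t -> g t <= M.
  apply: contrapT => /forallNP h; move/eqP : xe; apply; apply: (@bdry_inj _ _ _ _ r) => //.
  apply: (bdry_mem etar hr); apply: asymptotic_sym; exists 0 => t t0.
  suff -> : r t = r' t by rewrite mdistxx.
  apply: (rays_meet cat hr hr') => [|M|//]; first by rewrite r0.
  have /existsNP [T /not_implyP [T0 /negP]] := h M; rewrite -ltNge => MT.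
  have dT := mdist_ge0 (r T) (r' T).
  by exists T; move: MT dT; rewrite /g; move: (d _ _) => a; lra.
have bg : has_ubound (range g').
  by exists M => _ [t _ <-]; apply: hM; rewrite le_max lexx.
have cg := nondecreasing_cvgr ndg bg.
set S := sup _ in cg.
have -> : ext_gromov_prod o (inr xi) (inr eta) = S%:E.
  apply: cvg_lim => //; apply: cvg_EFin; first by near=> t.
  apply: cvg_trans cg; apply: near_eq_cvg; near=> t.
  have t0 : 0 <= t by near: t; apply: nbhs_pinfty_ge; rewrite num_real.
  by rewrite /= gE// /g' max_r.
have gS : has_sup (range g') by split => //; exists (g' 0), 0.
split => [t t0|e /= Se].
  rewrite visEg ler_expR lerN2; have /ubP := sup_upper_bound gS; apply.
  by exists t => //; rewrite /g' max_r.
have e0 : 0 < e := lt_trans (expR_gt0 _) Se.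
(* As [expR (- S) < e], the supremum [S] exceeds [- ln e], hence so does some value of [g']. *)
have : 0 < S + ln e by rewrite -ltrBlDl sub0r -ltr_expR lnK.
move=> /sup_adherent/(_ gS) [_ [t _ <-]]; rewrite opprD addrA subrr add0r => ht.
exists (Num.max 0 t); first by rewrite le_max lexx.
by rewrite visEg -[e in _ < e]lnK// ltr_expR ltrNl.
Unshelve. all: by end_near. Qed.

End FellowTravelling.

(** * The visual metric: Busemann estimate, triangle inequality, compactness *)

Section VisualMetric.
Context {R : realType} {Z : metricType R}.
Local Notation d := (@mdist R Z).
Local Notation bdry := (boundary Z).
Implicit Types (r c : R -> Z) (x y o : Z) (xi eta : bdry) (s t u v : R).
Variable delta0 : R.
Hypothesis cat : cat_minus_one Z.
Hypothesis hyp : hyperbolicity_constant Z delta0.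
Hypothesis proper : proper_space Z.

Lemma dvisxx o xi : dvis o xi xi = 0.
Proof. by rewrite /dvis eqxx. Qed.

Lemma dvis_ge0 o xi eta : 0 <= dvis o xi eta.
Proof. by rewrite /dvis; case: ifP => // _; exact: expR_ge0. Qed.

Lemma gromov_prodC o x y : gromov_prod o x y = gromov_prod o y x.
Proof. by rewrite /gromov_prod (metric_sym y) (addrC (d o y)). Qed.

Lemma dvis_sym o xi eta : dvis o xi eta = dvis o eta xi.
Proof.
rewrite /dvis eq_sym; case: ifP => [_|_]; first by [].
rewrite /ext_gromov_prod.
by under eq_fun do rewrite gromov_prodC.
Qed.

Lemma dvis_le1 o xi eta : dvis o xi eta <= 1.
Proof.
have [r xir r0] := ray_from cat hyp proper o xi.
have [r' etar r'0] := ray_from cat hyp proper o eta.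
have [h _] := visE_limit cat hyp proper xir etar r0 r'0.
by apply: (le_trans (h 0 (lexx _))); rewrite /visE r0 r'0 mdistxx mul0r subrr expR0.
Qed.

(** For [T] large, [visE r r' T < E]; then [ray_close] is applied at a time beyond both [T] and
    [v]. *)
Lemma dvis_close o xi eta r r' E v : val xi r -> val eta r' -> r 0 = o -> r' 0 = o ->
  dvis o xi eta < E -> 0 <= v -> d (r v) (r' v) <= 2 * (E * expR v).
Proof.
move=> xir etar r0 r'0 hE v0.
have [_ /(_ _ hE) [T T0 hT]] := visE_limit cat hyp proper xir etar r0 r'0.
have T'0 : 0 < T + v + 1 by rewrite ltr_wpDl// addr_ge0.
have vT' : 0 <= v <= T + v + 1 by rewrite v0 -addrA addrCA lerDl addr_ge0.
have TT' : T <= T + v + 1 by rewrite -addrA lerDl addr_ge0.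
have rr' : r 0 = r' 0 by rewrite r0.
apply: (le_trans (ray_close cat (bdry_ray xir) (bdry_ray etar) rr' T'0 vT')).
rewrite ler_pM2l// expRD ler_pM2r ?expR_gt0//.
exact/ltW/hT.
Qed.

(** The left-hand side tends to the exponential of the Busemann function of [r] at [r' u]. The bound
    is [ray_comparison] at the times [t] and [u] with legs of length [t], divided by [expR t]. *)
Lemma dvis_busemann o xi eta r r' a u : val xi r -> val eta r' -> r 0 = o -> r' 0 = o ->
  dvis o xi eta < a -> 0 <= u ->
  exists2 T, 0 <= T & forall t, T <= t ->
    expR (d (r t) (r' u) - t) <= expR (- u) + a ^+ 2 * expR u.
Proof.
move=> xir etar r0 r'0 da u0.
have rr' : r 0 = r' 0 by rewrite r0.
(* The gap between [a1 ^+ 2] and [a ^+ 2] will absorb the error term [expR (u - 2 * t)]. *)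
pose a1 := (dvis o xi eta + a) / 2.
have D0 := dvis_ge0 o xi eta.
have da1 : dvis o xi eta < a1 by rewrite /a1; lra.
have a1a : a1 < a by rewrite /a1; lra.
have aa : 0 < a ^+ 2 - a1 ^+ 2 by rewrite subr_gt0 ltr_sqr ?nnegrE; lra.
have [T1 T10 hT1] := (visE_limit cat hyp proper xir etar r0 r'0).2 _ da1.
have [T2 T20 hT2] := expRN_small aa.
exists (T1 + T2 + u + 1) => [|t Tt]; first by rewrite !addr_ge0.
have t0 : 0 < t by lra.
have tt : 0 <= t <= t by rewrite lexx ltW.
have ut : 0 <= u <= t by lra.
have := ray_comparison cat (bdry_ray xir) (bdry_ray etar) rr' t0 tt ut.
have -> : d (r t) (r' t) - 2 * t = 2 * (d (r t) (r' t) / 2 - t) by field.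
rewrite expRM_natl -/(visE r r' t).
have E0 : 0 <= visE r r' t := expR_ge0 _.
have hE : visE r r' t ^+ 2 <= a1 ^+ 2.
  have T1t : T1 <= t by lra.
  by rewrite ler_sqr ?nnegrE//; [exact/ltW/hT1|exact: le_trans D0 (ltW da1)].
have st := sinhR_le (ltW t0); have su := sinhR_le u0.
have st0 := sinhR_ge0 (ltW t0); have su0 := sinhR_ge0 u0.
have ss : sinhR t * sinhR u <= expR t / 2 * (expR u / 2) by exact: ler_pM.
have sE : visE r r' t ^+ 2 * (sinhR t * sinhR u) <= a1 ^+ 2 * (expR t / 2 * (expR u / 2)).
  by apply: ler_pM => //; [exact: sqr_ge0|exact: mulr_ge0].
have hc : 2 * coshR (t - u) = expR t * expR (- u) + expR u * expR (- t).
  by rewrite /coshR opprB !expRD; field.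
have h2 : expR (- t) * expR (- t) <= a ^+ 2 - a1 ^+ 2.
  have et : expR (- t) <= a ^+ 2 - a1 ^+ 2 by apply: hT2; lra.
  have et1 : expR (- t) <= 1 by rewrite expR_le1; lra.
  by apply: le_trans et; rewrite ger_pMl ?expR_gt0.
have := expR_le_coshR (d (r t) (r' u)).
rewrite expRD => h3 h4; rewrite mulrC.
have h5 : expR (d (r t) (r' u)) <=
    expR t * expR (- u) + expR u * expR (- t) + a1 ^+ 2 * (expR t * expR u).
  by move: hc h3 h4 sE; move: (coshR _) (coshR _) => ? ? *; lra.
have := ler_wpM2l (expR_ge0 (- t)) h5; move=> /le_trans; apply.
have := expRxN t; move: (expR t) (expR (- t)) h2 (expR_gt0 u) => e e' h2 u1 ee'.
rewrite [leLHS](_ : _ = expR (- u) * (e * e') + expR u * (e' * e') +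
  a1 ^+ 2 * (e * e') * expR u); last by ring.
rewrite ee' !mulr1; have := ler_wpM2l (ltW u1) h2.
by move: (expR u) (expR (- u)) => p q h; clear -h; lra.
Qed.

(* With [u = exp (- v)], comparing through the point at distance [v] on the ray to
   [zeta] gives [D^2 <= (u + a^2 / u) (u + b^2 / u)]; the choice [u^2 = a b] makes
   the right-hand side [(a + b)^2]. *)
Lemma dvis_triangle o xi zeta eta :
  dvis o xi eta <= dvis o xi zeta + dvis o zeta eta.
Proof.
have [r xir r0] := ray_from cat hyp proper o xi.
have [r' zr' r'0] := ray_from cat hyp proper o zeta.
have [r'' er'' r''0] := ray_from cat hyp proper o eta.
suff h a b : dvis o xi zeta < a -> dvis o zeta eta < b -> dvis o xi eta <= a + b.
  apply/ler_addgt0Pr => e e0; have e20 : 0 < e / 2 by rewrite divr_gt0.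
  by rewrite [e]splitr addrACA h// ltrDl.
(* If [a + b > 1], the diameter bound suffices; otherwise [a * b <= 1], so the time [v] below is
   nonnegative. *)
move=> ha hb; have [ab1|/ltW ab1] := leP 1 (a + b).
  exact: le_trans (dvis_le1 _ _ _) ab1.
have a0 := le_lt_trans (dvis_ge0 _ _ _) ha.
have b0 := le_lt_trans (dvis_ge0 _ _ _) hb.
have ab0 : 0 < a * b by rewrite mulr_gt0.
have ab1' : a * b <= 1 by nra.
pose v := - ln (a * b) / 2.
have v0 : 0 <= v by rewrite divr_ge0// oppr_ge0 ln_le0.
have [T1 T10 h1] := dvis_busemann xir zr' r0 r'0 ha v0.
rewrite dvis_sym in hb.
have [T2 T20 h2] := dvis_busemann er'' zr' r''0 r'0 hb v0.
pose t := T1 + T2; have t0 : 0 <= t by rewrite addr_ge0.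
have := (visE_limit cat hyp proper xir er'' r0 r''0).1 t t0.
move=> /le_trans; apply.
have vv : expR (- v) * expR (- v) = a * b.
  by rewrite -expRD -[RHS]lnK// /v; congr expR; field.
have {}h1 := h1 t (ltac:(by rewrite /t lerDl)).
have {}h2 := h2 t (ltac:(by rewrite /t lerDr)).
rewrite -ler_sqr ?nnegrE ?expR_ge0 ?addr_ge0 ?(ltW a0) ?(ltW b0)//.
apply: (@le_trans _ _ (expR (d (r t) (r' v) - t) * expR (d (r'' t) (r' v) - t))).
  rewrite /visE -expRM_natl -expRD ler_expR.
  have := metric_triangle (r t) (r' v) (r'' t); rewrite (metric_sym (r' v) (r'' t)).
  by move: (d _ _) (d _ _) (d _ _) => *; lra.
apply: (le_trans (ler_pM (expR_ge0 _) (expR_ge0 _) h1 h2)).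
have := expRxN v; move: (expR v) (expR (- v)) vv => e e' e2 ee'.
rewrite (_ : _ * _ = e' * e' + (a ^+ 2 + b ^+ 2) * (e * e') +
  (a * b) * (a * b) * (e * e)); last by ring.
rewrite -{1}e2 ee' (_ : _ * (e * e) = (e * e') ^+ 2 * (a * b)); last first.
  by rewrite -e2; ring.
by rewrite ee' e2 le_eqVlt; apply/orP; left; apply/eqP; ring.
Qed.

(** The rays from [o] to the [x n] accumulate at a ray, whose endpoint is the required point: two
    rays less than 1 apart at the single time [T + 1] have endpoints at visual distance at most
    [expR (- T)]. *)
Lemma dvis_compact o (x : nat -> bdry) :
  exists xi, forall N e, 0 < e -> exists2 n, (N <= n)%N & dvis o (x n) xi < e.
Proof.
have choice_ray n : exists g, val (x n) g /\ g 0 = o.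
  by have [g xg g0] := ray_from cat hyp proper o (x n); exists g.
have [r hr] := choice choice_ray.
have [||g [hg g0 glim]] := ray_limit proper (c := r) (o := o).
- by move=> n; have [] := hr n.
- by move=> t t0; exists 0%N => n _ s u /andP[s0 _] /andP[u0 _]; apply: (bdry_ray (hr n).1).
have [xi xig] := ray_bdry hg; exists xi => N e e0.
have e20 : 0 < e / 2 by rewrite divr_gt0.
have [T T0 hT] := expRN_small e20.
have T1 : 0 <= T + 1 by rewrite addr_ge0.
have [n Nn h] := glim _ _ T1 ltr01 N; exists n => //.
have [h1 _] := visE_limit cat hyp proper (hr n).1 xig (hr n).2 g0.
apply: (le_lt_trans (h1 _ T1)); apply: (@le_lt_trans _ _ (expR (- T))).
  by rewrite /visE ler_expR; move: h; move: (d _ _) => a h; lra.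
by apply: (le_lt_trans (hT _ (lexx _))); lra.
Qed.

End VisualMetric.

(** * The two games in a compact space, with at most one active obstacle near each ball *)

Section AbstractGames.
Context {R : realType} {T : Type} (dist : T -> T -> R) (X : set T) (t0 : R).
Hypothesis dist_sym : forall x y, dist x y = dist y x.
Hypothesis dist_triangle : forall x y z, dist x z <= dist x y + dist y z.
Hypothesis distxx : forall x, dist x x = 0.
Hypothesis dist_compact : forall x : nat -> T,
  exists z, forall N e, 0 < e -> exists2 n, (N <= n)%N & dist (x n) z < e.
Hypothesis X_closed : dist_closed dist X.
Implicit Types (w : T * R) (x y z : T).

Lemma dist_closed_limit (A : set T) z : dist_closed dist A ->
  (forall e, 0 < e -> exists2 y, A y & dist y z < e) -> A z.
Proof.
move=> cA h; apply: contrapT => /cA [e e0 he].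
have [y Ay yz] := h e e0; apply: (he y) => //.
by rewrite dist_sym.
Qed.

Lemma dist_ball_closed x e : dist_closed dist [set y | dist x y <= e].
Proof.
move=> y /= /negP; rewrite -ltNge => h; exists (dist x y - e).
  by rewrite subr_gt0.
move=> z h2; apply/negP; rewrite -ltNge.
have := dist_triangle x z y; rewrite (dist_sym z).
by move: h h2; move: (dist _ _) (dist _ _) (dist _ _) => *; lra.
Qed.

Lemma psi_center w : X w.1 -> psi dist X w w.1.
Proof. by move=> Xw; split; rewrite // distxx expR_ge0. Qed.

(** An accumulation point of the centres lies in each ball, because the balls are closed and
    nested. *)
Lemma psi_limit (w : nat -> T * R) : (forall k, X (w k).1) ->
  (forall k, psi dist X (w k.+1) `<=` psi dist X (w k)) ->
  (\bigcap_k psi dist X (w k)) !=set0.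
Proof.
move=> Xw nested; have [z hz] := dist_compact (fun n => (w n).1).
have nested' k n : (k <= n)%N -> psi dist X (w n) `<=` psi dist X (w k).
  by elim: n => [|n IH]; [rewrite leqn0 => /eqP ->|
    rewrite leq_eqVlt => /predU1P[->//|/IH h]; exact: subset_trans h].
exists z => k _; split.
- apply: dist_closed_limit X_closed _ => e e0.
  by have [n _ h] := hz 0%N e e0; exists (w n).1.
- apply: (dist_closed_limit (@dist_ball_closed _ _)) => e e0.
  have [n kn h] := hz k e e0; exists (w n).1 => //.
  by have [] := nested' _ _ kn _ (psi_center (Xw n)).
Qed.

(* [Sy m y] is the obstacle that player A removes when the resonant point [y] of
   index [m] is close to the current ball; by [Sy_unique] there is at most one. *)
Variables (dm : nat -> R) (bC : nat -> set T) (Sy : nat -> T -> set T) (L : R).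
Variable (SS : set (set T)).
Hypothesis dm_ge0 : forall m, 0 <= dm m.
Hypothesis L_ge0 : 0 <= L.
Hypothesis SySS : forall m y, bC m y -> SS (Sy m y).
Hypothesis Sy_self : forall m y, bC m y -> Sy m y y.
Hypothesis Sy_unique : forall m m' y y' t, bC m y -> bC m' y' ->
  dm m + L <= t -> dm m' + L <= t -> dist y y' <= 4 * expR (- t) ->
  Sy m y = Sy m' y'.
Hypothesis SS_nonempty : SS !=set0.

(** [S] is an obstacle already active at time [w.2] that comes from a resonant point dangerously
    close to the ball of [w]. *)
Definition threat (a : R) w (S : set T) : Prop := exists m y z,
  [/\ bC m y, dm m + L <= w.2, psi dist X w z,
      dist y z <= expR (- (w.2 + a)) & S = Sy m y].

(** Two threatening points are joined by a chain of four steps through the centre of the ball, each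
    of length at most [expR (- w.2)]; hence the factor 4 in [Sy_unique]. *)
Lemma threat_unique a w S S' : 0 <= a -> threat a w S -> threat a w S' -> S = S'.
Proof.
move=> a0 [m [y [z [my ht [_ wz] yz ->]]]] [m' [y' [z' [my' ht' [_ wz'] yz' ->]]]].
apply: (Sy_unique (t := w.2)) => //.
have ea : expR (- (w.2 + a)) <= expR (- w.2).
  by rewrite ler_expR lerN2 lerDl.
have := dist_triangle y z y'; have := dist_triangle z w.1 y'.
have := dist_triangle w.1 z' y'; rewrite (dist_sym z w.1) (dist_sym z' y').
move: wz wz' yz yz' ea; move: (dist _ _) (dist _ _) (dist _ _) (dist _ _) (dist _ _).
by move: (dist _ _) (dist _ _) (expR _) (expR _) => *; lra.
Qed.

Lemma threatSS a w S : threat a w S -> SS S.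
Proof. by move=> [m [y [z [/SySS + _ _ _ ->]]]]. Qed.

(* A resonant point too close to [z] would have been a threat, hence removed, at the
   first stage [k] with [dm j + L <= (w k).2]. *)
Lemma limit_Bad a (w : nat -> T * R) (b : R) z : 0 <= a -> 0 < b ->
  (forall k, b <= (w k.+1).2 - (w k).2) ->
  (exists2 B, 0 <= B & forall k, (w k.+1).2 - (w k).2 <= B) ->
  (forall k, psi dist X (w k) z) ->
  (forall k S, threat a (w k) S -> ~ thickening dist (expR (- ((w k).2 + a))) S z) ->
  Bad dist X (family_of dm bC) z.
Proof.
move=> a0 b0 step [B B0 hB] hz hS; split; first by case: (hz 0%N).
(* [c] is so large that at the first active stage [k] one has [t k <= dm j + c - a]: either [k = 0],
   or the stage before was inactive and one step adds at most [B]. *)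
pose t k := (w k).2; pose c := `|t 0%N| + L + B + a.
have c0 : 0 <= c by rewrite !addr_ge0.
exists c => // -[m _] /= -[y [j /= jm jy] yz].
have grow k : t 0%N + k%:R * b <= t k.
  elim: k => [|k IH]; first by rewrite mul0r addr0.
  by have := step k; rewrite -/(t _) -/(t k) -natr1 mulrDl; lra.
have ex : exists k, dm j + L <= t k.
  pose u := (dm j + L - t 0%N) / b.
  exists (Num.trunc `|u|).+1; apply: le_trans (grow _).
  rewrite -lerBlDl -ler_pdivrMr// (le_trans (ler_norm _))// -/u.
  exact/ltW/truncnS_gt.
have [k hk kmin] := ex_minnP ex.
have tk : t k <= dm j + c - a.
  case: k hk kmin => [|k] hk kmin.
    move: (ler_norm (t 0%N)) (dm_ge0 j) B0 L_ge0; rewrite /c.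
    by move: (`|t 0%N|) (t 0%N) (dm j) => *; lra.
  have : t k < dm j + L by rewrite ltNge; apply/negP => /kmin; rewrite ltnn.
  move: (hB k) (normr_ge0 (t 0%N)); rewrite -/(t k) -/(t k.+1) /c.
  by move: (`|t 0%N|) (t k) (t k.+1) (dm j) => *; lra.
have yzk : dist y z <= expR (- (t k + a)).
  apply: (le_trans yz); rewrite ler_expR lerN2; lra.
have thr : threat a (w k) (Sy j y) by exists j, y, z; split.
by apply: (hS k _ thr); exists y => //; exact: Sy_self.
Qed.

Lemma last_history w0 (w : nat -> T * R) k : last w0 (history w k) = w k.
Proof. by rewrite /history mkseqS last_rcons. Qed.

(** A union over all threats, which by [threat_unique] is empty or one neighbourhood; thus it needs
    no choice of a threat and still gives a legal move. *)
Definition threat_set (a : R) w : set T :=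
  [set z | exists2 S, threat a w S & thickening dist (expR (- (w.2 + a))) S z].

Lemma threat_setE a w S : 0 <= a -> threat a w S ->
  threat_set a w = thickening dist (expR (- (w.2 + a))) S.
Proof.
move=> a0 thr; apply/seteqP; split => z /=; last by exists S.
by move=> [S' thr']; rewrite (threat_unique a0 thr' thr).
Qed.

Lemma threat_set0 a w : ~ (exists S, threat a w S) -> threat_set a w = set0.
Proof.
by move=> h; apply/seteqP; split => // z [S thr _]; apply: h; exists S.
Qed.

Lemma diffuse_threat a w : 0 <= a -> diffuse dist X t0 a SS -> Omega X t0 w ->
  exists2 x, X x & psi dist X (x, w.2 + a) `<=` psi dist X w `\` threat_set a w.
Proof.
case: w => x t a0 diff Ok.
have [[S thr]|nthr] := pselect (exists S, threat a (x, t) S).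
  rewrite (threat_setE a0 thr); exact: diff Ok (threatSS thr).
(* Without a threat, avoiding an arbitrary member of [SS] still yields a smaller ball. *)
have [S SSS] := SS_nonempty; have [y Xy hy] := diff _ _ _ Ok SSS.
by exists y => //; rewrite threat_set0// setD0 => z /hy [].
Qed.

Lemma threat_setS a b w : a <= b -> 0 <= a -> threat_set b w `<=` threat_set a w.
Proof.
move=> ab a0 z [S [m [y [z' [my ht wz yz ->]]]] [y' Sy' yz']].
have eb : expR (- (w.2 + b)) <= expR (- (w.2 + a)).
  by rewrite ler_expR lerN2 lerD2l.
exists (Sy m y); last by exists y' => //; exact: le_trans eb.
by exists m, y, z'; split => //; exact: le_trans eb.
Qed.

(** Player A removes the threat set at scale [b]. It is contained in the one at scale [beta <= b],
    which diffuseness lets B avoid, so B keeps a legal move; [limit_Bad] with [a = b] settles the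
    outcome. *)
Lemma abstract_absolute_winning beta : 0 < beta -> diffuse dist X t0 beta SS ->
  absolute_winning dist X t0 SS (Bad dist X (family_of dm bC)).
Proof.
move=> beta0 diff; exists beta => // b betab; have b0 := lt_le_trans beta0 betab.
(* In an empty space no play can begin; otherwise [p] serves as default for the empty history. *)
have [[p _]|noT] := pselect (exists p : T, True); last first.
  by exists (fun=> set0) => follows; split=> w; have [] := noT; exists (w 0%N).1.
pose sigma (h : seq (T * R)) := threat_set b (last (p, 0) h) `&` X.
have sigmaE (w : nat -> T * R) k : sigma (history w k) = threat_set b (w k) `&` X.
  by rewrite /sigma last_history.
exists sigma => follows; split=> w.
- move=> k w0 hw; have Ok : Omega X t0 (w k).
    by case: k hw => [//|k] /(_ k (ltnSn _)) [].
  rewrite sigmaE; split.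
    have [[S thr]|/threat_set0 ->] := pselect (exists S, threat b (w k) S).
      right; exists S, b; split => //; first exact: threatSS thr.
      by rewrite (threat_setE (ltW b0) thr).
    by left; rewrite set0I.
  have [x Xx hx] := diffuse_threat (ltW beta0) diff Ok.
  exists (x, (w k).2 + beta); split => /=.
  + by split => //=; rewrite ltr_wpDr ?(ltW beta0)//; case: Ok.
  + by exists beta; rewrite ?lexx.
  + move=> z /hx [wz nz]; split => //.
    by move=> [/(threat_setS betab (ltW beta0))].
- move=> w0 hw.
  have Xw k : X (w k).1 by case: k => [|k]; [case: w0|case: (hw k) => -[]].
  have nested k : psi dist X (w k.+1) `<=` psi dist X (w k).
    by case: (hw k) => _ _ h z /h [].
  have [z hz] := psi_limit Xw nested; exists z; split => //.
  apply: (@limit_Bad b w beta z (ltW b0) beta0) => [k||k|k S thr].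
  + by have [_ [b' /andP[? _] ->] _] := hw k; rewrite addrAC subrr add0r.
  + exists b => [|k]; first exact: ltW.
    by have [_ [b' /andP[_ ?] ->] _] := hw k; rewrite addrAC subrr add0r.
  + exact: hz.
  + have [_ _ /(_ z (hz k.+1 I)) [_]] := hw k; rewrite sigmaE => nz Sz; apply: nz.
    by split; [exists S|case: (hz k I)].
Qed.

(* The point [p] is needed because a strategy is also defined on the empty history. *)
Lemma abstract_schmidt_winning (p : T) a : 0 < a -> diffuse dist X t0 a SS ->
  schmidt_winning dist X t0 (Bad dist X (family_of dm bC)).
Proof.
move=> a0 diff; exists 0, a; split => //; split => // b b0.
(* Player A answers with a ball that itself avoids the threat set, and B has to stay inside it. *)
have choice_x w : exists x, Omega X t0 w -> X x /\
    psi dist X (x, w.2 + a) `<=` psi dist X w `\` threat_set a w.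
  have [Ok|] := pselect (Omega X t0 w); last by exists p.
  by have [x Xx hx] := diffuse_threat (ltW a0) diff Ok; exists x.
have [f hf] := choice choice_x.
pose sigma (h : seq (T * R)) := let w := last (p, 0) h in (f w, w.2 + a).
have sigmaE (w : nat -> T * R) k : sigma (history w k) = (f (w k), (w k).2 + a).
  by rewrite /sigma last_history.
have legal (w : nat -> T * R) k : Omega X t0 (w k) ->
    nested_move dist X t0 a (w k) (sigma (history w k)) /\
    psi dist X (sigma (history w k)) `<=` psi dist X (w k) `\` threat_set a (w k).
  move=> Ok; rewrite sigmaE; have [Xf h] := hf _ Ok; split => //.
  split => //; last by move=> z /h [].
  by split => //=; rewrite ltr_wpDr ?(ltW a0)//; case: Ok.
exists sigma => follows; split=> w.
- move=> k w0 hw; have Ok : Omega X t0 (w k).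
    by case: k hw => [//|k] /(_ k (ltnSn _)) [].
  by have [] := legal w k Ok.
- move=> w0 hw.
  have Ok k : Omega X t0 (w k) by case: k => [//|k]; case: (hw k).
  have Xw k : X (w k).1 by case: (Ok k).
  have nested k : psi dist X (w k.+1) `<=` psi dist X (w k) `\` threat_set a (w k).
    have [_ h] := legal w k (Ok k); case: (hw k) => _ _ h'.
    exact: subset_trans h' h.
  have [z hz] := psi_limit Xw (fun k z h => (nested k z h).1); exists z; split => //.
  have step k : (w k.+1).2 - (w k).2 = a + b.
    by have [_ -> _] := hw k; rewrite sigmaE/=; ring.
  apply: (@limit_Bad a w (a + b) z (ltW a0)) => [|k||k|k S thr Sz].
  + exact: addr_gt0.
  + by rewrite step.
  + by exists (a + b) => [|k]; [rewrite addr_ge0 ?ltW|rewrite step].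
  + exact: hz.
  + by have [_] := nested k z (hz k.+1 I); apply; exists S.
Qed.

End AbstractGames.

(** * Rays towards convex sets, and Busemann functions *)

Section ConvexFamilies.
Context {R : realType} {Z : metricType R}.
Local Notation d := (@mdist R Z).
Local Notation bdry := (boundary Z).
Implicit Types (r c g : R -> Z) (x y o q : Z) (xi eta : bdry) (s t u v : R).
Variable delta0 : R.
Hypothesis cat : cat_minus_one Z.
Hypothesis hyp : hyperbolicity_constant Z delta0.
Hypothesis proper : proper_space Z.

(** The triangle with vertices [o], [q], [xi] is thin, and [g v] is too far from [o] to be close to
    the side from [o] to [q]. *)
Lemma ray_near_ray o q xi g r v : val xi g -> g 0 = o -> val xi r -> r 0 = q ->
  d o q + delta0 < v -> 0 <= v -> exists2 a, 0 <= a & d (r a) (g v) <= delta0.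
Proof.
move=> xig g0 xir r0 qv v0.
have gv : geod (inl o) (inr xi) (g v) by exists g => //; exists v.
have [p [[cp sp [t /andP[t0 tq] cpt]]|[r' [xir' r'0] [t t0 r't]]] pv] :=
  hyp.2 (inl o) (inr xi) (inl q) _ gv.
  have gv' : d o (g v) = v by rewrite -g0 ray_dist0//; exact: bdry_ray xig.
  have op : d o p = t by rewrite -cpt (segment_dist0 sp)// t0.
  have := metric_triangle o p (g v); rewrite gv' op; clear -tq qv pv.
  by move=> h; exfalso; move: h qv tq pv; move: (d p _) (d o q) => *; lra.
exists t => //; rewrite (_ : r t = p)// -r't.
apply: (ray_unique cat) => //; [exact: bdry_ray xir|exact: bdry_ray xir'|by rewrite r0|].
exact: bdry_asymptotic xir xir'.
Qed.

Lemma ray_near_convex (C : set Z) o q xi g v : closed C -> geod_convex C -> C q ->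
  boundary_of C xi -> val xi g -> g 0 = o -> d o q + delta0 < v -> 0 <= v ->
  thickening d delta0 C (g v).
Proof.
move=> cC gC Cq [r xir Cr] xig g0 qv v0.
have [r' [xir' r'0 Cr']] := ray_from_convex cat hyp proper cC gC Cq xir Cr.
have [a a0 h] := ray_near_ray xig g0 xir' r'0 qv v0.
by exists (r' a) => //; exact: Cr'.
Qed.

Lemma dist_to_ge0 o (C : set Z) : 0 <= dist_to o C.
Proof.
have [[y Cy]|C0] := pselect (C !=set0).
  by apply: lb_le_inf; [exists (d o y), y|move=> _ [z _ <-]; exact: mdist_ge0].
rewrite /dist_to (_ : C = set0); first by rewrite image_set0 inf0.
by apply/seteqP; split => // z Cz; apply: C0; exists z.
Qed.

Lemma dist_to_near o (C : set Z) : C !=set0 -> exists2 q, C q & d o q < dist_to o C + 1.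
Proof.
move=> [y Cy]; have hC : has_inf [set d o y | y in C].
  by split; [exists (d o y), y|exists 0 => _ [z _ <-]; exact: mdist_ge0].
by have [_ [q Cq <-] h] := inf_adherent (@ltr01 R) hC; exists q.
Qed.

Lemma boundary_of_nonempty (C : set Z) xi : boundary_of C xi -> C !=set0.
Proof. by move=> [r _ h]; exists (r 0); exact: h. Qed.

(** The function [t - d (r t) z] is nondecreasing and bounded for [t >= 0], so the Busemann function
    is an infimum as well as a limit. *)
Lemma busemann_limit r z : is_ray r ->
  (forall t, 0 <= t -> busemann r z <= d (r t) z - t) /\
  (forall e, 0 < e -> exists T, forall t, T <= t -> d (r t) z - t < busemann r z + e).
Proof.
move=> hr; pose f t := t - d (r t) z.
have f_mono s t : 0 <= s -> s <= t -> f s <= f t.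
  move=> s0 st; have t0 := le_trans s0 st.
  have := metric_triangle (r t) (r s) z; rewrite hr// ger0_norm ?subr_ge0// /f.
  by move: (d _ _) (d _ _) => *; lra.
pose f' t := f (Num.max 0 t).
have ndf : {homo f' : s t / s <= t}.
  move=> s t st; apply: f_mono; [rewrite le_max lexx|rewrite ge_max].
    by [].
  by rewrite ?le_max ?lexx ?st ?orbT.
have bf : has_ubound (range f').
  exists (d (r 0) z) => _ [t _ <-]; rewrite /f' /f.
  have m0 : 0 <= Num.max 0 t by rewrite le_max lexx.
  have := metric_triangle (r 0) z (r (Num.max 0 t)); rewrite ray_dist0//.
  by rewrite (metric_sym z); move: (d _ _) (d _ _) => *; lra.
have cf := nondecreasing_cvgr ndf bf; set S := sup _ in cf.
have -> : busemann r z = - S.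
  have cN : (- f') t @[t --> +oo] --> - S by exact: cvgN.
  apply: cvg_lim => //; apply: cvg_trans cN; apply: near_eq_cvg.
  near=> t; have t0 : 0 <= t by near: t; apply: nbhs_pinfty_ge; rewrite num_real.
  by rewrite -[LHS]/(- f' t) /f' max_r// /f opprB.
have fS : has_sup (range f') by split => //; exists (f' 0), 0.
split => [t t0|e e0].
  rewrite lerNl opprB; have /ubP := sup_upper_bound fS; apply.
  by exists t => //; rewrite /f' max_r.
have [_ [t _ <-] ht] := sup_adherent e0 fS.
exists (Num.max 0 t) => u tu; have := f_mono _ _ _ tu.
rewrite le_max lexx => /(_ isT); move: ht; rewrite -/S /f' /f.
by move: (Num.max 0 t) => m; move: (d _ _) (d _ _) => *; lra.
Unshelve. all: by end_near. Qed.

Lemma busemann_lip r z w : is_ray r -> busemann r z <= busemann r w + d w z.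
Proof.
move=> hr; apply/ler_addgt0Pr => e e0.
have [T hT] := (busemann_limit w hr).2 _ e0.
have T'0 : 0 <= Num.max 0 T by rewrite le_max lexx.
have TT' : T <= Num.max 0 T by rewrite le_max lexx orbT.
have := (busemann_limit z hr).1 _ T'0; have := hT _ TT'.
have := metric_triangle (r (Num.max 0 T)) w z.
by move: (Num.max 0 T) => m; move: (d _ _) (d _ _) (d _ _) (busemann _ _) (busemann _ _) => *; lra.
Qed.

(** For large [t] the segment from [g 0] to [r t] fellow-travels [g] up to time [v], so moving to
    [g v] brings one closer to [r t] by [v], up to [delta0]. *)
Lemma busemann_ray r g v : is_ray r -> is_ray g -> asymptotic g r -> 0 <= v ->
  busemann r (g v) <= busemann r (g 0) - v + delta0.
Proof.
move=> hr hg [K hK] v0; set o := g 0.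
have [T hT] : exists T, forall t, T <= t -> d (r t) (g v) <= delta0 + d o (r t) - v.
  exists (v + d o (r 0) + `|K|) => t vt; have K1 := ler_norm K; have K0 := normr_ge0 K.
  have or0 := mdist_ge0 o (r 0); have t0 : 0 <= t by lra.
  have [c hc] := cat.1 o (r t).
  have vg : v <= gromov_prod o (g t) (r t).
    rewrite /gromov_prod ray_dist0//.
    have := hK _ t0; have := metric_triangle (r 0) o (r t); rewrite ray_dist0//.
    rewrite (metric_sym (r 0) o); move: vt K0 K1 or0; move: (`|K|).
    by move: (d _ _) (d _ _) (d _ _) => *; lra.
  have vgc : 0 <= v <= gromov_prod o (g t) (r t) by rewrite v0.
  have h := fellow_travel cat hyp (ray_segment hg t0) hc vgc.
  have vc : 0 <= v <= d o (r t) by rewrite v0 (le_trans vg)// (gromov_prod_le _ _ _).2.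
  have h2 := segment_dist1 hc vc.
  have := metric_triangle (r t) (c v) (g v); rewrite (metric_sym (r t) (c v)) h2.
  rewrite (metric_sym (c v)); move: h; move: (d _ _) (d _ _) (d _ _) => *; lra.
apply/ler_addgt0Pr => e e0.
have [T' hT'] := (busemann_limit o hr).2 _ e0.
pose t := `|T| + `|T'|.
have t0 : 0 <= t by rewrite addr_ge0.
have Tt : T <= t by rewrite (le_trans (ler_norm T))// lerDl.
have T't : T' <= t by rewrite (le_trans (ler_norm T'))// lerDr.
have := (busemann_limit (g v) hr).1 _ t0; have := hT _ Tt; have := hT' _ T't.
rewrite (metric_sym o).
by clearbody t; move: (d _ _) (d _ _) (busemann _ _) (busemann _ _) => *; lra.
Qed.

(** A ray [p] in the horoball has bounded Busemann values, so a far point [p t] has a large Gromov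
    product with far points of [r]. The segment from [r 0] to [p t] then fellow-travels both [r] and
    the ray [g] from [r 0] to [xi]. *)
Lemma boundary_horoball r s xi : is_ray r ->
  boundary_of [set z | busemann r z <= s] xi -> val xi r.
Proof.
move=> hr [p xip hp]; apply: (bdry_mem xip hr); have hp' := bdry_ray xip.
have [g xig g0] := ray_from cat hyp proper (r 0) xi.
apply: (asymptotic_trans (bdry_asymptotic xip xig)); apply: asymptotic_sym.
have [K hK] := bdry_asymptotic xip xig.
exists (2 * delta0) => v v0.
(* With this [t], both Gromov products used below are at least [v]. *)
pose t := 2 * v + `|K| + `|s| + d (r 0) (p 0) + 1.
have tE : t = 2 * v + `|K| + `|s| + d (r 0) (p 0) + 1 by [].
have K1 := ler_norm K; have K0 := normr_ge0 K.
have s1 := ler_norm s; have s0 := normr_ge0 s.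
have D0 := mdist_ge0 (r 0) (p 0).
have t0 : 0 <= t by rewrite /t; lra.
have [T hT] := (busemann_limit (p t) hr).2 _ ltr01.
have bp : busemann r (p t) <= s by exact: hp.
pose T' := `|T| + v + d (r 0) (p 0) + t.
have TT' : T <= T' by have := ler_norm T; rewrite /T'; lra.
have T'0 : 0 <= T' by have := normr_ge0 T; rewrite /T'; lra.
have {}hT := hT _ TT'.
have [c hc] := cat.1 (r 0) (p t).
have tri : t - d (r 0) (p 0) <= d (r 0) (p t).
  have := metric_triangle (p 0) (r 0) (p t); rewrite ray_dist0// (metric_sym (p 0)).
  by move: (d _ _) (d _ _) => *; lra.
have h1 : d (r v) (c v) <= delta0.
  apply: (fellow_travel cat hyp (ray_segment hr T'0) hc).
  rewrite v0/= /gromov_prod ray_dist0//; move: tri hT bp D0 tE.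
  move: (`|K|) (`|s|) K0 K1 s0 s1; clearbody t T'.
  by move: (d _ _) (d _ _) (d _ _) (busemann _ _) => *; lra.
have h2 : d (g v) (c v) <= delta0.
  have hg := bdry_ray xig; have := ray_segment hg t0; rewrite g0 => sg.
  apply: (fellow_travel cat hyp sg hc).
  have := hK _ t0; rewrite metric_sym => gp.
  rewrite v0/= /gromov_prod -{1}g0 ray_dist0//; move: tri gp D0 tE.
  move: (`|K|) (`|s|) K0 K1 s0 s1; clearbody t.
  by move: (d _ _) (d _ _) (d _ _) => *; lra.
have := metric_triangle (r v) (c v) (g v); rewrite (metric_sym (c v)).
by move: h1 h2; move: (d _ _) (d _ _) (d _ _) => *; lra.
Qed.

End ConvexFamilies.

(** * Separation of the limit points of active convex sets *)

Section Separation.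
Context {R : realType} {Z : metricType R}.
Local Notation d := (@mdist R Z).
Local Notation bdry := (boundary Z).
Implicit Types (r c g : R -> Z) (x y o q : Z) (xi eta : bdry) (s t u v : R).
Variable delta0 : R.
Hypothesis cat : cat_minus_one Z.
Hypothesis hyp : hyperbolicity_constant Z delta0.
Hypothesis proper : proper_space Z.
Hypothesis delta0_gt0 : 0 < delta0.

(** Choose [h] with [10 * expR (- h) <= delta0]; the factor 10 is the 2 of [dvis_close] times 5,
    where 5 makes the bound with 4 strict. *)
Lemma dvis_fellow : exists2 h, 0 <= h & forall o xi eta g g' t v,
  val xi g -> val eta g' -> g 0 = o -> g' 0 = o ->
  dvis o xi eta <= 4 * expR (- t) -> 0 <= v -> v + h <= t -> d (g v) (g' v) <= delta0.
Proof.
have e0 : 0 < delta0 / 10 by rewrite divr_gt0.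
have [h h0 hh] := expRN_small e0; exists h => // o xi eta g g' t v xig etag g0 g'0 dv v0 vt.
have dv5 : dvis o xi eta < 5 * expR (- t).
  by apply: (le_lt_trans dv); rewrite ltr_pM2r ?expR_gt0// ltr_nat.
apply: (le_trans (dvis_close cat hyp proper xig etag g0 g'0 dv5 v0)).
rewrite -mulrA -expRD addrC -[v - t]opprB.
have : expR (- (t - v)) <= delta0 / 10 by apply: hh; rewrite lerBrDl.
by move: (expR _) => e; lra.
Qed.

(** The factor 4 is the one of [Sy_unique]. *)
Definition separated_family o (C : nat -> set Z) L := forall m m' xi eta t,
  m <> m' -> boundary_of (C m) xi -> boundary_of (C m') eta ->
  dist_to o (C m) + L <= t -> dist_to o (C m') + L <= t ->
  dvis o xi eta <= 4 * expR (- t) -> False.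

(** At time [t - h] each ray is at depth at least [delta0] in its own horoball, and the two rays are
    [delta0]-close, so one point lies in both horoballs. *)
Lemma horoballs_separated o (C : nat -> set Z) : disjoint_horoballs C ->
  exists2 L, 0 <= L & separated_family o C L.
Proof.
move=> [hC disj]; have [h h0 hh] := dvis_fellow.
exists (h + 2 * delta0 + 1) => [|m m' xi eta t mm' mxi meta ht ht' dv].
  by rewrite !addr_ge0// mulr_ge0// ltW.
have [g xig g0] := ray_from cat hyp proper o xi.
have [g' etag g'0] := ray_from cat hyp proper o eta.
have dm := dist_to_ge0 o (C m); have dm' := dist_to_ge0 o (C m').
have dl0 := delta0_gt0.
pose v := t - h; have v0 : 0 <= v by rewrite /v; lra.
have vt : v + h <= t by rewrite /v; lra.
have gg := hh _ _ _ _ _ _ _ xig etag g0 g'0 dv v0 vt.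
have deep k zeta f : boundary_of (C k) zeta -> val zeta f -> f 0 = o ->
    dist_to o (C k) + (h + 2 * delta0 + 1) <= t ->
    exists r s, [/\ is_ray r, C k = [set z | busemann r z <= s] &
      busemann r (f v) <= s - delta0].
  move=> kz zf f0 kt; have [r [s [hr CE]]] := hC k; exists r, s; split => //.
  have zr : val zeta r by apply: (boundary_horoball cat hyp proper hr (s := s)); rewrite -CE.
  have [q Cq oq] := dist_to_near o (boundary_of_nonempty kz).
  have bq : busemann r q <= s by rewrite CE in Cq.
  have := busemann_ray cat hyp hr (bdry_ray zf) (bdry_asymptotic zf zr) v0.
  have := busemann_lip o q hr; rewrite f0 (metric_sym q).
  move: kt oq bq; rewrite /v; move: (d _ _) (busemann _ _) (busemann _ _) (busemann _ _).
  by move: (dist_to _ _) => *; lra.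
have [r [s [hr CE b1]]] := deep _ _ _ mxi xig g0 ht.
have [r' [s' [hr' CE' b2]]] := deep _ _ _ meta etag g'0 ht'.
have : (C m `&` C m') (g v).
  rewrite CE CE'; split => /=; first by lra.
  have := busemann_lip (g v) (g' v) hr'; rewrite (metric_sym (g' v)).
  by move: gg b2; move: (d _ _) (busemann _ _) (busemann _ _) => *; lra.
by rewrite (disj _ _ mm').
Qed.

(** Throughout a time interval of length [T + 1] the ray [g] lies in both
    [2 * delta0]-neighbourhoods, whose intersection has diameter at most [T]. *)
Lemma embedded_separated o (C : nat -> set Z) T : 0 <= T -> embedded (2 * delta0) T C ->
  (forall m, closed (C m) /\ geod_convex (C m)) ->
  exists2 L, 0 <= L & separated_family o C L.
Proof.
move=> T0 emb cC; have [h h0 hh] := dvis_fellow; have dl0 := delta0_gt0.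
exists (h + T + delta0 + 2) => [|m m' xi eta t mm' mxi meta ht ht' dv].
  by rewrite !addr_ge0// ltW.
have [g xig g0] := ray_from cat hyp proper o xi.
have [g' etag g'0] := ray_from cat hyp proper o eta.
have dm := dist_to_ge0 o (C m); have dm' := dist_to_ge0 o (C m').
have near k zeta f v : boundary_of (C k) zeta -> val zeta f -> f 0 = o ->
    dist_to o (C k) + 1 + delta0 <= v -> thickening d delta0 (C k) (f v).
  move=> kz zf f0 kv; have [q Cq oq] := dist_to_near o (boundary_of_nonempty kz).
  have [clC cvC] := cC k; have := dist_to_ge0 o (C k) => dk.
  apply: (ray_near_convex cat hyp proper clC cvC Cq kz zf f0); lra.
have both v : t - h - T - 1 <= v <= t - h ->
    (thickening d (2 * delta0) (C m) `&` thickening d (2 * delta0) (C m')) (g v).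
  move=> vt; have v0 : 0 <= v by lra.
  have vt' : v + h <= t by lra.
  have gg := hh _ _ _ _ _ _ _ xig etag g0 g'0 dv v0 vt'; split.
    have [|y Cy yg] := near m xi g v mxi xig g0; first by lra.
    by exists y => //; move: yg; move: (d _ _) => *; lra.
  have [|y Cy yg] := near m' eta g' v meta etag g'0; first by lra.
  exists y => //; have := metric_triangle y (g' v) (g v); rewrite (metric_sym (g' v)).
  by move: yg gg; move: (d _ _) (d _ _) (d _ _) => *; lra.
have h1 : t - h - T - 1 <= t - h <= t - h by lra.
have h2 : t - h - T - 1 <= t - h - T - 1 <= t - h by lra.
have := emb _ _ mm' _ _ (both _ h1) (both _ h2).
rewrite (bdry_ray xig); [|lra|lra].
have -> : t - h - (t - h - T - 1) = T + 1 by ring.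
by rewrite ger0_norm; lra.
Qed.

(** The parameter [f] of the ray along the line is an isometric map of the half-line into the reals,
    determined by its values at 0 and 1. *)
Lemma ray_in_line c r : is_line c -> is_ray r -> (forall t, 0 <= t -> range c (r t)) ->
  exists a (e : bool), forall t, 0 <= t -> r t = c (a + (-1) ^+ e * t).
Proof.
move=> hc hr rc.
have [f hf] : exists f : R -> R, forall t, 0 <= t -> r t = c (f t).
  have [|f hf] := @choice R R (fun t u => 0 <= t -> r t = c u); last by exists f.
  move=> t; by have [/rc [u _ uE]|_] := boolP (0 <= t); [exists u|exists 0].
have fE s t : 0 <= s -> 0 <= t -> `|f s - f t| = `|s - t|.
  by move=> s0 t0; rewrite -hc -!hf// hr.
pose a := f 0.
have f_sqr s t : 0 <= s -> 0 <= t -> (f s - f t) ^+ 2 = (s - t) ^+ 2.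
  by move=> s0 t0; rewrite -[LHS](real_normK (num_real _)) fE// real_normK ?num_real.
have f1 : (f 1 - a) ^+ 2 = 1 by rewrite f_sqr// subr0 expr1n.
have ft t : 0 <= t -> f t = a + (f 1 - a) * t.
  move=> t0; have := f_sqr t 0 t0 (lexx _); have := f_sqr t 1 t0 ler01.
  rewrite subr0 -/a; move: (f t) (f 1) a f1 => x y b e1 e2 e3.
  have : (x - b) * (y - b) = t by lra.
  move=> <-; rewrite mulrCA -expr2 e1; ring.
have : (f 1 - a == 1) || (f 1 - a == -1) by rewrite -sqrf_eq1 f1.
move=> /orP[] /eqP e; exists a; [exists false|exists true] => t t0;
  by rewrite hf// ft// e.
Qed.

Lemma line_half c u (e : bool) : is_line c -> is_ray (fun t => c (u + (-1) ^+ e * t)).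
Proof.
move=> hc s t s0 t0; rewrite hc opprD addrACA subrr add0r -mulrBr normrM.
by rewrite normrX normrN1 expr1n mul1r.
Qed.

(** The ray agrees with a half-line of [c]; moving its starting parameter from [a] to [u] costs the
    bounded distance [|a - u|]. *)
Lemma line_endpoint c u xi r : is_line c -> val xi r -> (forall t, 0 <= t -> range c (r t)) ->
  exists e : bool, val xi (fun t => c (u + (-1) ^+ e * t)).
Proof.
move=> hc xir rc; have hr := bdry_ray xir.
have [a [e rE]] := ray_in_line hc hr rc; exists e.
apply: (bdry_mem xir (line_half u e hc)); exists `|a - u| => t t0.
by rewrite rE// hc opprD addrACA subrr addr0.
Qed.

(** For opposite ends, the points at time [v] of the two rays would be [delta0]-close to points of
    the line more than [4 * delta0] apart, although the rays are themselves [delta0]-close at that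
    time. *)
Lemma line_endpoints_separated o : exists2 L, 0 <= L & forall (C : set Z) xi eta t,
  geodesic_line C -> boundary_of C xi -> boundary_of C eta ->
  dist_to o C + L <= t -> dvis o xi eta <= 4 * expR (- t) -> xi = eta.
Proof.
have [h h0 hh] := dvis_fellow; have dl0 := delta0_gt0.
exists (h + 3 * delta0 + 1) => [|C xi eta t [c hc CE] Cxi Ceta ht dv].
  by rewrite !addr_ge0// mulr_ge0// ltW.
have [q Cq oq] := dist_to_near o (boundary_of_nonempty Cxi).
have dm := dist_to_ge0 o C.
have [g xig g0] := ray_from cat hyp proper o xi.
have [g' etag g'0] := ray_from cat hyp proper o eta.
pose v := t - h; have v0 : 0 <= v by rewrite /v; lra.
have vt : v + h <= t by rewrite /v; lra.
have gg := hh _ _ _ _ _ _ _ xig etag g0 g'0 dv v0 vt.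
have [u _ uq] : range c q by rewrite -CE.
have near (zeta : bdry) f (e : bool) : val zeta f -> f 0 = o ->
    val zeta (fun t => c (u + (-1) ^+ e * t)) ->
    exists2 a, v - d o q - delta0 <= a & d (c (u + (-1) ^+ e * a)) (f v) <= delta0.
  move=> zf f0 zc.
  have c0 : c (u + (-1) ^+ e * 0) = q by rewrite mulr0 addr0.
  have qv : d o q + delta0 < v by move: oq; rewrite /v; move: (d _ _) => *; lra.
  have [a a0 ha] := ray_near_ray cat hyp zf f0 zc c0 qv v0.
  exists a => //.
  have := metric_triangle (f 0) q (f v); rewrite (ray_dist0 (bdry_ray zf))// f0.
  have := metric_triangle q (c (u + (-1) ^+ e * a)) (f v).
  have -> : d q (c (u + (-1) ^+ e * a)) = a.
    rewrite -uq hc opprD addrA subrr add0r normrN normrM normrX normrN1 expr1n mul1r.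
    by rewrite ger0_norm.
  by move: ha; move: (d _ _) (d _ _) (d _ _) => *; lra.
have [p xip pC] := Cxi; have [p' etap' p'C] := Ceta.
have [e xie] : exists e : bool, val xi (fun t => c (u + (-1) ^+ e * t)).
  by apply: line_endpoint hc xip _ => s s0; rewrite -CE; exact: pC.
have [e' etae] : exists e : bool, val eta (fun t => c (u + (-1) ^+ e * t)).
  by apply: line_endpoint hc etap' _ => s s0; rewrite -CE; exact: p'C.
have [ee|ee] := eqVneq e e'; first by rewrite -ee in etae; exact: bdry_inj xie etae.
have [a va ha] := near _ _ _ xig g0 xie; have [a' va' ha'] := near _ _ _ etag g'0 etae.
have cc : a + a' <= d (c (u + (-1) ^+ e * a)) (c (u + (-1) ^+ e' * a')).
  rewrite hc opprD addrACA subrr add0r.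
  have -> : (-1) ^+ e * a - (-1) ^+ e' * a' = (-1) ^+ e * (a + a').
    by case: e e' ee {xie etae ha ha' near} => -[]//= _; rewrite !(expr0, expr1); ring.
  by rewrite normrM normrX normrN1 expr1n mul1r ler_norm.
have := metric_triangle (c (u + (-1) ^+ e * a)) (g v) (c (u + (-1) ^+ e' * a')).
have := metric_triangle (g v) (g' v) (c (u + (-1) ^+ e' * a')).
rewrite (metric_sym (g' v)); move: oq va va' gg ha ha' cc; rewrite /v.
by move: (d _ _) (d _ _) (d _ _) (d _ _) (d _ _) => *; exfalso; lra.
Qed.

End Separation.

(** * The winning statements for horoballs and embedded convex sets *)

Section ConvexWinning.
Context {R : realType} {Z : metricType R}.
Local Notation bdry := (boundary Z).
Variables (o : Z) (delta0 t0 : R) (X : set bdry) (C : nat -> set Z).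
Hypothesis cat : cat_minus_one Z.
Hypothesis hyp : hyperbolicity_constant Z delta0.
Hypothesis proper : proper_space Z.
Hypothesis delta0_gt0 : 0 < delta0.
Hypothesis X_closed : dist_closed (dvis o) X.
Hypothesis C_closed : forall m, closed (C m) /\ geod_convex (C m).

Lemma convex_separated : disjoint_horoballs C \/ embedded_convex_sets delta0 C ->
  exists2 L, 0 <= L & separated_family o C L.
Proof.
case=> [hC|[_ [T T0 emb]]]; first exact: (horoballs_separated cat hyp proper delta0_gt0 o hC).
exact: (embedded_separated cat hyp proper delta0_gt0 o T0 emb C_closed).
Qed.

Lemma convex_boundary_inhabited :
  disjoint_horoballs C \/ embedded_convex_sets delta0 C -> exists p : bdry, True.
Proof.
case=> [[hC _]|[bC _]]; last by have [p _] := bC 0%N; exists p.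
by have [r [s [hr _]]] := hC 0%N; have [xi _] := ray_bdry hr; exists xi.
Qed.

(** The obstacle is the single resonant point, so uniqueness is also required inside one [C m]: a
    horoball has one limit point, and the ends of a line are separated. *)
Lemma convex_absolute_points :
  disjoint_horoballs C \/
    (embedded_convex_sets delta0 C /\ forall m, geodesic_line (C m)) ->
  (exists2 beta : R, 0 < beta & diffuse (dvis o) X t0 beta point_sets) ->
  absolute_winning (dvis o) X t0 point_sets (Bad (dvis o) X (convex_family o C)).
Proof.
move=> hC [beta beta0 diff].
have hC' : disjoint_horoballs C \/ embedded_convex_sets delta0 C.
  by case: hC => [|[]]; [left|right].
have [p _] := convex_boundary_inhabited hC'.
have [L L0 sep] := convex_separated hC'.
have [L' L'0 sep'] : exists2 L', 0 <= L' & forall m xi eta t,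
    boundary_of (C m) xi -> boundary_of (C m) eta ->
    dist_to o (C m) + L' <= t -> dvis o xi eta <= 4 * expR (- t) -> xi = eta.
  case: hC => [[hC _]|[_ line]].
    exists 0 => // m xi eta t mxi meta _ _; have [r [s [hr CE]]] := hC m.
    rewrite CE in mxi meta.
    apply: bdry_inj (boundary_horoball cat hyp proper hr mxi) _.
    exact: (boundary_horoball cat hyp proper hr meta).
  have [L' L'0 h] := line_endpoints_separated cat hyp proper delta0_gt0 o.
  exists L' => // m xi eta t; exact: h.
apply: (abstract_absolute_winning (dvis_sym o) (dvis_triangle cat hyp proper o)
  (dvisxx o) (dvis_compact cat hyp proper o) X_closed
  (Sy := fun _ y => [set y]) (L := L + L') _ _ _ _ _ _ beta0 diff).
- by move=> m; exact: dist_to_ge0.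
- exact: addr_ge0.
- by move=> m y _; exists y.
- by [].
- move=> m m' y y' t my my' ht ht' dv; congr [set _].
  have [mm'|/eqP mm'] := eqVneq m m'.
    rewrite -mm' in my'; apply: sep' my my' _ dv.
    by apply: le_trans ht; rewrite lerD2l lerDr.
  exfalso; apply: (sep _ _ _ _ _ mm' my my' _ _ dv).
  + by apply: le_trans ht; rewrite lerD2l lerDl.
  + by apply: le_trans ht'; rewrite lerD2l lerDl.
- by exists [set p], p.
Qed.

(** The obstacle is all of [boundary_of (C m)], so uniqueness only concerns different indices. *)
Lemma convex_winning_boundaries :
  disjoint_horoballs C \/ embedded_convex_sets delta0 C ->
  (exists2 bstar : R, 0 < bstar &
     diffuse (dvis o) X t0 bstar (range (fun m => boundary_of (C m)))) ->
  absolute_winning (dvis o) X t0 (range (fun m => boundary_of (C m)))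
    (Bad (dvis o) X (convex_family o C)) /\
  schmidt_winning (dvis o) X t0 (Bad (dvis o) X (convex_family o C)).
Proof.
move=> hC [beta beta0 diff].
have [p _] := convex_boundary_inhabited hC.
have [L L0 sep] := convex_separated hC.
have unique m m' y y' t : boundary_of (C m) y -> boundary_of (C m') y' ->
    dist_to o (C m) + L <= t -> dist_to o (C m') + L <= t ->
    dvis o y y' <= 4 * expR (- t) -> boundary_of (C m) = boundary_of (C m').
  move=> my my' ht ht' dv; have [->//|/eqP mm'] := eqVneq m m'.
  by exfalso; apply: (sep _ _ _ _ _ mm' my my' ht ht' dv).
have dm0 m : 0 <= dist_to o (C m) by exact: dist_to_ge0.
split.
- apply: (abstract_absolute_winning (dvis_sym o) (dvis_triangle cat hyp proper o)
    (dvisxx o) (dvis_compact cat hyp proper o) X_closed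
    (Sy := fun m _ => boundary_of (C m)) dm0 L0 _ _ unique _ beta0 diff) => //.
  by exists (boundary_of (C 0%N)), 0%N.
- apply: (abstract_schmidt_winning (dvis_sym o) (dvis_triangle cat hyp proper o)
    (dvisxx o) (dvis_compact cat hyp proper o) X_closed
    (Sy := fun m _ => boundary_of (C m)) dm0 L0 _ _ unique _ p beta0 diff) => //.
  by exists (boundary_of (C 0%N)), 0%N.
Qed.

End ConvexWinning.

(** * Hyperbolic space: extension of geodesics, homogeneity, packing *)

Section HyperbolicSpace.
Context {R : realType}.

(* The right-hand side is the point at signed distance [s] from [u] on the geodesic
   through [u] and [v], where [l] is the distance from [u] to [v]. *)
Lemma hyperboloid_geodesic_extension n (u v w : 'rV[R]_n.+1) l s : 0 < l ->
  hyperboloid u -> hyperboloid v -> hyperboloid w ->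
  lorentz u v = - coshR l -> lorentz u w = - coshR s -> lorentz v w = - coshR (s - l) ->
  w = (sinhR s / sinhR l) *: v - (sinhR (s - l) / sinhR l) *: u.
Proof.
move=> l0 hu hv hw uv uw vw; have sl := sinhR_gt0 l0.
set A := sinhR s / sinhR l; set B := sinhR (s - l) / sinhR l.
have [uu vv ww] := And3 hu.1 hv.1 hw.1.
apply/eqP; rewrite -subr_eq0; apply/eqP.
have -> : w - (A *: v - B *: u) = w + (- A *: v + B *: u).
  by rewrite opprB addrC -addrA scaleNr addrC addrA (addrC w) addrAC.
(* The difference of the two sides is orthogonal to [u] and isotropic. *)
apply: (lorentz_perp_isotropic hu).
  rewrite !lorentzDr !lorentzZr uv uw uu /A /B sinhRB.
  by field; rewrite gt_eqF.
rewrite !(lorentzDl, lorentzDr, lorentzZl, lorentzZr) uu vv ww.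
rewrite (lorentzC w u) (lorentzC v u) (lorentzC w v) uv uw vw /A /B sinhRB coshRB.
have := sqr_coshR s; have := sqr_coshR l; move: sl.
move: (coshR s) (sinhR s) (coshR l) (sinhR l) => C S c t t0 ct CS.
by field: ct CS; rewrite gt_eqF.
Qed.

(** Otherwise [- x] would lie on the hyperboloid, and [hyperboloid_lorentz] would make [lorentz x v]
    positive. *)
Lemma hyperboloid_sign n (v x : 'rV[R]_n.+1) :
  hyperboloid v -> lorentz x x = -1 -> lorentz x v < 0 -> hyperboloid x.
Proof.
move=> hv xx xv; split=> //; rewrite ltNge; apply/negP => x0.
have hx : hyperboloid (- x).
  have -> : - x = (-1) *: x by rewrite scaleN1r.
  split; first by rewrite lorentzZl lorentzZr xx; ring.
  rewrite !mxE mulN1r oppr_gt0 lt_neqAle x0 andbT; apply/eqP => x00.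
  have : 0 <= lorentz x x.
    by rewrite lorentzE x00 expr0n subr0 sumr_ge0// => i _; exact: sqr_ge0.
  by rewrite xx; lra.
have := hyperboloid_lorentz hx hv.
have -> : - x = (-1) *: x by rewrite scaleN1r.
rewrite lorentzZl; lra.
Qed.

(** The reflection in the hyperplane orthogonal to [u - v]; on the hyperboloid,
    [lorentz (u - v) (u - v)] is twice the denominator. *)
Definition lorentz_reflection n (u v w : 'rV[R]_n.+1) : 'rV[R]_n.+1 :=
  w + (- (lorentz w (u - v) / (-1 - lorentz u v))) *: (u - v).

Lemma lorentz_reflectionP n (u v : 'rV[R]_n.+1) : hyperboloid u -> hyperboloid v ->
  -1 - lorentz u v != 0 ->
  [/\ lorentz_reflection u v u = v,
      forall w w', lorentz (lorentz_reflection u v w) (lorentz_reflection u v w') = lorentz w w' &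
      forall w, hyperboloid w -> hyperboloid (lorentz_reflection u v w)].
Proof.
move=> hu hv uv0; have [uu vv] := conj hu.1 hv.1.
have BN w : lorentz w (u - v) = lorentz w u - lorentz w v.
  by rewrite -[X in u + X]scaleN1r lorentzDr lorentzZr mulN1r.
have BN' w : lorentz (u - v) w = lorentz u w - lorentz v w.
  by rewrite -[X in u + X]scaleN1r lorentzDl lorentzZl mulN1r.
have uE : lorentz_reflection u v u = v.
  by rewrite /lorentz_reflection BN uu divff// scaleN1r opprB addrC subrK.
have isom w w' : lorentz (lorentz_reflection u v w) (lorentz_reflection u v w') = lorentz w w'.
  rewrite /lorentz_reflection; move: (u - v) BN BN' => N BN BN'.
  rewrite !(lorentzDl, lorentzDr, lorentzZl, lorentzZr) !BN !BN'.
  rewrite uu vv (lorentzC v u) (lorentzC u w') (lorentzC v w').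
  by move: (lorentz u v) uv0 => a uv0; field.
split=> // w hw; apply: (hyperboloid_sign hv); first by rewrite isom; exact: hw.1.
by rewrite -{2}uE isom; have := hyperboloid_lorentz hw hu; lra.
Qed.

Context {Z : metricType R} {n : nat}.
Local Notation d := (@mdist R Z).
Hypothesis hZ : is_hyperbolic_space Z n.
Implicit Types (r : R -> Z) (o p x y : Z) (s t : R).

(** The point at time [s] is given by [hyperboloid_geodesic_extension] from the points at times 0
    and [l] alone. *)
Lemma ray_extension_unique r r' l : is_ray r -> is_ray r' -> r 0 = r' 0 -> 0 < l ->
  r l = r' l -> forall s, l <= s -> r s = r' s.
Proof.
move=> hr hr' rr' l0 rl s ls; have [f [[fH finj _] fd]] := hZ.
have hf p : hyperboloid (f p) by exact: fH.
have s0 : 0 <= s by exact: le_trans (ltW l0) ls.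
have lor p q : lorentz (f p) (f q) = - coshR (d p q).
  by rewrite fd coshR_hyp_dist// opprK.
apply: finj; rewrite ?inE//.
have ext g : is_ray g -> g 0 = r 0 -> g l = r l -> f (g s) =
    (sinhR s / sinhR l) *: f (r l) - (sinhR (s - l) / sinhR l) *: f (r 0).
  move=> hg g0 gl; apply: hyperboloid_geodesic_extension => //; rewrite lor.
  - by rewrite ray_dist0// ltW.
  - by rewrite -g0 ray_dist0.
  - by rewrite -gl hg ?(ltW l0)// distrC ger0_norm// subr_ge0.
by rewrite (ext r)// (ext r').
Qed.

Lemma endpoint_through_unique o x xi eta : o <> x ->
  endpoint_through o x xi -> endpoint_through o x eta -> xi = eta.
Proof.
move=> ox [r xir [r0 rx]] [r' etar [r'0 r'x]].
have l0 : 0 < d o x by rewrite mdist_gt0; apply/eqP.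
have hr := bdry_ray xir; have hr' := bdry_ray etar.
have h := ray_extension_unique hr hr' (etrans r0 (esym r'0)) l0 (etrans rx (esym r'x)).
(* The rays coincide after time [d o x]; before it they are at most twice that time apart. *)
apply: bdry_inj xir (bdry_mem etar hr _).
exists (2 * d o x) => t t0; rewrite metric_sym.
have [tl|lt] := leP t (d o x); last by rewrite (h _ (ltW lt)) mdistxx mulr_ge0// mdist_ge0.
have := metric_triangle (r t) (r 0) (r' t).
rewrite (metric_sym (r t) (r 0)) ray_dist0// r0 -r'0 ray_dist0//.
by rewrite r'0; move: (d _ _) (d _ _) tl => *; lra.
Qed.

(** Reflect in the perpendicular bisector of [p] and [q]; the case [p = q], where the denominator
    vanishes, is taken care of by the identity. *)
Lemma homogeneous p q : exists2 phi : Z -> Z,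
  phi p = q & forall x y, d (phi x) (phi y) = d x y.
Proof.
have [->|pq] := eqVneq p q; first by exists id.
have [f [[fH finj fsurj] fd]] := hZ.
have hf x : hyperboloid (f x) by exact: fH.
have lor x y : lorentz (f x) (f y) = - coshR (d x y).
  by rewrite fd coshR_hyp_dist// opprK.
have pq0 : -1 - lorentz (f p) (f q) != 0.
  rewrite lor opprK addrC subr_eq0 gt_eqF// -coshR0; apply: coshR_lt => //.
  by rewrite mdist_gt0.
have [fpq isom hyperb] := lorentz_reflectionP (hf p) (hf q) pq0.
have choice_phi x : exists y, f y = lorentz_reflection (f p) (f q) (f x).
  by have [y _ yE] := fsurj _ (hyperb _ (hf x)); exists y.
have [phi hphi] := choice choice_phi.
exists phi => [|x y].
  by apply: finj; rewrite ?inE// hphi fpq.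
by rewrite !fd /hyp_dist !hphi isom.
Qed.

(* [M] does not depend on the centre [p], by homogeneity. *)
Lemma uniform_packing K tau : proper_space Z -> 0 < tau -> exists M, forall p,
  exists code : Z -> nat, (forall x, d p x <= K -> (code x < M)%N) /\
    (forall x y, d p x <= K -> d p y <= K -> code x = code y -> d x y < tau).
Proof.
move=> proper tau0; have [[p0 _]|noZ] := pselect (exists p : Z, True); last first.
  by exists 0%N => p; case: noZ; exists p.
have e0 : 0 < tau / 2 by rewrite divr_gt0.
pose near x c := d c x < tau / 2.
have [l hasl] : exists l : seq Z, forall x, d p0 x <= K -> has (near x) l.
  apply: contrapT => /forallNP nol.
  (* If no finite list of centres suffices, the sets of points of the ball missed by finite lists
     generate a proper filter, and a cluster point [p] of it contradicts the list [[:: p]]. *)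
  pose F := filter_from [set: seq Z] (fun l => [set x | d p0 x <= K /\ ~~ has (near x) l]).
  have FF : ProperFilter F.
    apply: filter_from_proper; last first.
      by move=> l _; have /existsNP[x /not_implyP[xK /negP]] := nol l; exists x.
    apply: filter_from_filter; first by exists [::].
    move=> l l' _ _; exists (l ++ l') => // x /= [xK].
    by rewrite has_cat negb_or => /andP[].
  have FK : F [set x | d p0 x <= K] by exists [::] => // x [].
  have [p [_ clp]] := @proper p0 K F FF FK.
  have FN : F [set x | ~~ near x p].
    by exists [:: p] => // x [_]; rewrite /= orbF.
  have [x [/= /negP]] := clp _ _ FN (nbhsx_ballx p _ e0).
  by rewrite ballEmdist.
exists (size l) => p; have [phi phip isom] := homogeneous p p0.
exists (fun x => find (near (phi x)) l); split=> [x px|x y px py xy].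
  by rewrite -has_find hasl// -phip isom.
rewrite -isom; have hx : has (near (phi x)) l by rewrite hasl// -phip isom.
have hy : has (near (phi y)) l by rewrite hasl// -phip isom.
have := nth_find p0 hx; have := nth_find p0 hy; rewrite -xy /near.
have := metric_triangle (phi x) (nth p0 l (find (near (phi x)) l)) (phi y).
rewrite (metric_sym (phi x) (nth _ _ _)).
by move: (d _ _) (d _ _) (d _ _) => *; lra.
Qed.

End HyperbolicSpace.

(** * Counting shadows against the power law *)

Section PowerLawDiffuse.
Context {R : realType}.

(** The left-hand side bounds the measure of the covering balls, the right-hand side is the lower
    bound for the covered ball. Their ratio is at most [Q * b * expR (- (tau * b))]. *)
Lemma exponential_beats_linear (ns M : nat) (L tau c1 c2 : R) :
  0 <= L -> 0 < tau -> 0 < c1 -> 0 < c2 ->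
  exists2 bs : R, 2 <= bs & forall b t, bs < b ->
    (ns%:R * (b + L) + 1) * M%:R * (c2 * expR (- (tau * (t + b - 2)))) <
    c1 * expR (- (tau * (t + 1))).
Proof.
move=> L0 tau0 c10 c20.
(* The factor [expR (3 * tau)] comes from [t + b - 2 = (t + 1) + b - 3]. Beyond [2 * Q / tau ^+ 2]
   the quadratic term of the exponential series exceeds [Q * b]. *)
pose Q := (ns%:R * (1 + L) + 1) * M%:R * (c2 * expR (3 * tau)) / c1.
have Q0 : 0 <= Q.
  by rewrite /Q !(mulr_ge0, addr_ge0, divr_ge0)// ?expR_ge0// ?invr_ge0 ltW.
have bs0 : 0 <= 2 * Q / tau ^+ 2 by apply: divr_ge0; [exact: mulr_ge0|exact: sqr_ge0].
exists (2 * Q / tau ^+ 2 + 2) => [|b t bb]; first by rewrite lerDr.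
have b2 : 2 < b by apply: le_lt_trans bb; rewrite lerDr.
have b0 : 0 < b by lra.
have Qb : Q * b < expR (tau * b).
  have tb0 : 0 <= tau * b by rewrite mulr_ge0// ltW.
  apply: lt_le_trans (expR_ge1Dxn 1 tb0); rewrite (_ : 2`!%:R = 2)//.
  have : 2 * Q / tau ^+ 2 < b by apply: le_lt_trans bb; rewrite lerDl.
  rewrite ltr_pdivrMr ?exprn_gt0// => h.
  have : 2 * Q * b < b * tau ^+ 2 * b by rewrite ltr_pM2r.
  by rewrite exprMn; lra.
have E1 : expR (- (tau * (t + b - 2))) =
    expR (3 * tau) * expR (- (tau * (t + 1))) * expR (- (tau * b)).
  by rewrite -!expRD; congr expR; ring.
rewrite E1; set e := expR (- (tau * (t + 1))).
have e0 : 0 < e by exact: expR_gt0.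
have nb : (ns%:R * (b + L) + 1) <= (ns%:R * (1 + L) + 1) * b.
  have n0 : 0 <= (ns%:R : R) by [].
  have : 0 <= ns%:R * L * (b - 1) by rewrite !mulr_ge0// subr_ge0; lra.
  by lra.
have := expRxN (tau * b); set f := expR (tau * b) in Qb *; set f' := expR (- _).
move=> ff'; have f'0 : 0 < f' by exact: expR_gt0.
have h1 : Q * b * f' < 1 by rewrite -ff' ltr_pM2r.
have X0 : 0 <= M%:R * (c2 * expR (3 * tau)) by rewrite !mulr_ge0// ?expR_ge0// ltW.
have h2 : (ns%:R * (b + L) + 1) * (M%:R * (c2 * expR (3 * tau))) <= Q * b * c1.
  rewrite /Q [leRHS](_ : _ = (ns%:R * (1 + L) + 1) * b * (M%:R * (c2 * expR (3 * tau)))).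
    exact: ler_wpM2r.
  by field; rewrite gt_eqF.
apply: (@le_lt_trans _ _ (Q * b * c1 * (e * f'))).
  rewrite [leLHS](_ : _ = (ns%:R * (b + L) + 1) * (M%:R * (c2 * expR (3 * tau))) * (e * f')).
    by rewrite ler_wpM2r// mulr_ge0// ltW.
  by ring.
by rewrite (_ : _ * (e * f') = Q * b * f' * (c1 * e)) ?gtr_pMl ?mulr_gt0//; ring.
Qed.

Context {Z : metricType R} {n : nat}.
Local Notation d := (@mdist R Z).
Local Notation bdry := (boundary Z).
Variables (o : Z) (delta0 : R).
Hypothesis cat : cat_minus_one Z.
Hypothesis hyp : hyperbolicity_constant Z delta0.
Hypothesis proper : proper_space Z.
Hypothesis hZ : is_hyperbolic_space Z n.
Implicit Types (xi eta : bdry) (s t b : R).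

Lemma borel_closed (xi0 : bdry) (A : set bdry) : dist_closed (dvis o) A ->
  measurable (A : set (borel_boundary o xi0)).
Proof.
by move=> cA; rewrite -[A]setCK; apply: measurableC; exact: sub_gen_smallest.
Qed.

Lemma borel_psi (xi0 : bdry) (X : set bdry) (w : bdry * R) : dist_closed (dvis o) X ->
  measurable (psi (dvis o) X w : set (borel_boundary o xi0)).
Proof.
move=> cX; have -> : psi (dvis o) X w = X `&` [set eta | dvis o w.1 eta <= expR (- w.2)] by [].
apply: (@measurableI _ (borel_boundary o xi0)); apply: borel_closed => //.
exact: (dist_ball_closed (dvis_sym o) (dvis_triangle cat hyp proper o)).
Qed.

Lemma dist_to1 x : dist_to o [set x] = d o x.
Proof. by rewrite /dist_to image_set1 inf1. Qed.

Lemma res_windowP (x : nat -> Z) t w eta : res_window (point_family o x) t w eta ->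
  exists j, endpoint_through o (x j) eta /\ t - w < d o (x j) <= t.
Proof.
move=> [[m /= mt [j /= jm jeta]] nw]; exists j; split => //.
rewrite !dist_to1 in mt jm *; apply/andP; split; last exact: le_trans mt.
rewrite ltNge; apply/negP => jw; apply: nw.
exists j; first by rewrite /= dist_to1.
by exists j => /=.
Qed.

(** At time [d o x] the rays to [xi] and [eta] are at most 4 apart, and rounding that time to [t]
    minus an integer costs at most 1. Integer positions along [g] can be counted. *)
Lemma shadow_close (x : Z) xi eta g t : val xi g -> g 0 = o ->
  endpoint_through o x eta -> d o x <= t -> dvis o xi eta <= expR (- t) ->
  d (g (t - (Num.trunc (t - d o x))%:R)) x <= 5.
Proof.
move=> xig g0 [r etar [r0 rx]] xt dv; set v := d o x in rx xt *.
have v0 : 0 <= v by exact: mdist_ge0.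
have tv0 : 0 <= t - v by rewrite subr_ge0.
have tr : (Num.trunc (t - v))%:R <= t - v by rewrite truncn_le.
have tr' := truncnS_gt (t - v).
rewrite -natr1 in tr'; set i := (Num.trunc _)%:R in tr tr' *.
have dv2 : dvis o xi eta < 2 * expR (- t).
  by apply: (le_lt_trans dv); rewrite ltr_pMl ?expR_gt0// ltr1n.
have := dvis_close cat hyp proper xig etar g0 r0 dv2 v0; rewrite rx -mulrA -expRD.
have : expR (- t + v) <= 1 by rewrite expR_le1; lra.
have := metric_triangle (g (t - i)) (g v) x.
rewrite (bdry_ray xig)//; last by lra.
rewrite ger0_norm; last by lra.
by move: (expR _) => e; move: (d _ _) (d _ _) => *; lra.
Qed.

(** If no centre works, each point of the ball of radius [expR (- (t + 1))] is close to a shadow.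
    Labelling shadows by integer position and packing code covers this ball by [a * M] balls of
    radius [expR (- (t + b - 2))], too few for the power law. *)
Lemma power_law_family_diffuse (ns : nat) (L tau tau0 c1 c2 : R) :
  0 <= L -> 0 < tau -> 0 < tau0 -> 0 < c1 -> 0 < c2 ->
  exists2 bs : R, 0 < bs &
  forall (t0 : R) (X : set bdry) (x : nat -> Z),
    0 < t0 -> dist_closed (dvis o) X -> (forall m, t0 < d o (x m)) ->
    separated_points tau0 x ->
  forall (xi0 : bdry) (mu : {measure set (borel_boundary o xi0) -> \bar R}),
    power_law (dvis o) X t0 mu c1 c2 tau ->
    family_diffuse (dvis o) X t0 bs ns L (point_family o x).
Proof.
move=> L0 tau_gt0 tau00 c10 c20.
have [M hM] := uniform_packing hZ 5 proper tau00.
have [bs bs2 hbs] := exponential_beats_linear ns M L0 tau_gt0 c10 c20.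
exists bs; first by apply: lt_le_trans bs2.
(* With [n' = 1] the removed neighbourhood has the radius of the new ball, so a failing centre is
   within twice that radius of a shadow. *)
move=> t0 X x t00 cX far sep xi0 mu pl b bsb; exists 1%N => xi t [/= Xxi tt0].
have b2 : 2 < b by exact: le_lt_trans bs2 bsb.
rewrite mul1r; set w := ns%:R * (b + L).
have w0 : 0 <= w by rewrite mulr_ge0// addr_ge0// ltW// (lt_trans _ b2).
have [g xig g0] := ray_from cat hyp proper o xi.
have [code hcode] := choice (fun i : nat => hM (g (t - i%:R))).
pose a := (Num.trunc w).+1.
pose idx j := Num.trunc (t - d o (x j)).
(* [P q zeta] says that [zeta] is close to a shadow with label [q]; the label encodes the pair of
   position and packing code in base [M]. *)
pose P (q : nat) zeta := exists eta j, [/\ endpoint_through o (x j) eta,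
  t - w < d o (x j) <= t, dvis o xi eta <= expR (- t),
  dvis o zeta eta <= 2 * expR (- (t + b)) & (idx j * M + code (idx j) (x j))%N = q].
have e1 : 2 * expR (- 1) <= 1 :> R.
  by have := expR_ge1Dx (1 : R); have := expRxN (1 : R);
     have := expR_gt0 (- 1 : R); move: (expR 1) (expR (- 1)) => p q *; nra.
have e2 : 4 * expR (- 2) <= 1 :> R.
  have -> : - 2 = - 1 + - 1 :> R by ring.
  by rewrite expRD; have := expR_gt0 (- 1 : R); move: e1; move: (expR (- 1)) => q *; nra.
have eb : expR (- b) <= expR (- 2) by rewrite ler_expR lerN2 ltW.
have et1 : 2 * expR (- (t + 1)) <= expR (- t).
  have -> : - (t + 1) = - t + - 1 by ring.
  by rewrite expRD mulrCA ger_pMr ?expR_gt0.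
have etb : 4 * expR (- (t + b)) <= expR (- t).
  rewrite opprD expRD mulrCA ger_pMr ?expR_gt0//.
  by apply: le_trans e2; rewrite ler_pM2l.
have codeM eta j : endpoint_through o (x j) eta -> d o (x j) <= t ->
    dvis o xi eta <= expR (- t) -> d (g (t - (idx j)%:R)) (x j) <= 5.
  by move=> h1 h2 h3; exact: shadow_close xig g0 h1 h2 h3.
(* Equal labels give points [x j] closer than [tau0], hence equal, with the same endpoint [eta];
   then [zeta] and [zeta'] are at most [4 * expR (- (t + b))] apart. *)
have P_unique q zeta zeta' : P q zeta -> P q zeta' ->
    dvis o zeta zeta' <= expR (- (t + b - 2)).
  move=> [eta [j [je /andP[_ jt] jxi jz jq]]] [eta' [j' [je' /andP[_ jt'] jxi' jz' jq']]].
  have cj := codeM _ _ je jt jxi; have cj' := codeM _ _ je' jt' jxi'.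
  have lj := (hcode _).1 _ cj; have lj' := (hcode _).1 _ cj'.
  have M0 : (0 < M)%N by exact: leq_ltn_trans lj.
  have ii : idx j = idx j'.
    have := congr1 (divn^~ M) (etrans jq (esym jq')).
    by rewrite !divnMDl// !divn_small// !addn0.
  have cc : code (idx j) (x j) = code (idx j) (x j').
    by apply/eqP; rewrite -(eqn_add2l (idx j * M)) jq -jq' ii.
  rewrite -ii in cj'.
  have xx : x j = x j'.
    apply: contrapT => /sep; apply/negP; rewrite -ltNge.
    exact: (hcode (idx j)).2 _ _ cj cj' cc.
  have eta_eq : eta = eta'.
    rewrite -xx in je'; apply: (endpoint_through_unique hZ _ je je') => ox.
    by have := far j; rewrite -ox mdistxx ltNge (ltW t00).
  rewrite -eta_eq in jz'; have := dvis_triangle cat hyp proper o zeta eta zeta'.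
  rewrite (dvis_sym o eta).
  have : 4 * expR (- (t + b)) <= expR (- (t + b - 2)).
    have -> : - (t + b) = - (t + b - 2) + - 2 by ring.
    by rewrite expRD mulrCA ger_pMr ?expR_gt0.
  move: jz jz'; move: (dvis _ _ _) (dvis _ _ _) (dvis _ _ _).
  by move: (expR (- (t + b))) (expR _) => *; lra.
(* A label that does not occur is given the default centre [xi]. *)
have choice_p q : exists p : bdry, X p /\
    forall zeta, X zeta -> P q zeta -> psi (dvis o) X (p, t + b - 2) zeta.
  have [[z [Xz Pz]]|nz] := pselect (exists z, X z /\ P q z).
    by exists z; split => // zeta Xzeta Pzeta; split => //; exact: P_unique Pz Pzeta.
  by exists xi; split => // zeta Xzeta Pzeta; case: nz; exists zeta.
have [p hp] := choice choice_p.
apply: contrapT => nodiff.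
have cover : psi (dvis o) X (xi, t + 1) `<=`
    \big[setU/set0]_(q < a * M) psi (dvis o) X (p q, t + b - 2).
  rewrite -(bigcup_mkord (a * M) (fun q => psi (dvis o) X (p q, t + b - 2))).
  move=> zeta [Xzeta /= xizeta].
  have /existsNP[z /not_implyP[[Xz /= zz] nz]] :
      ~ (psi (dvis o) X (zeta, t + b) `<=` psi (dvis o) X (xi, t) `\`
         thickening (dvis o) (expR (- (t + b))) (res_window (point_family o x) t w)).
    by move=> h; apply: nodiff; exists zeta.
  have [eta weta etaz] : thickening (dvis o) (expR (- (t + b)))
      (res_window (point_family o x) t w) z.
    apply: contrapT => nthick; apply: nz; split => //; split => //=.
    have := dvis_triangle cat hyp proper o xi zeta z; move: xizeta zz et1 etb.
    have := expR_gt0 (- (t + b)).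
    move: (expR (- (t + 1))) (expR (- (t + b))) (expR (- t)) => u1 u2 u3.
    by move: (dvis _ _ _) (dvis _ _ _) (dvis _ _ _) => *; lra.
  have [j [je jt]] := res_windowP weta.
  have zeta_eta : dvis o zeta eta <= 2 * expR (- (t + b)).
    have := dvis_triangle cat hyp proper o zeta z eta; rewrite (dvis_sym o z).
    move: zz etaz; move: (dvis _ _ _) (dvis _ _ _) (dvis _ _ _) (expR _) => *; lra.
  have xi_eta : dvis o xi eta <= expR (- t).
    have := dvis_triangle cat hyp proper o xi zeta eta; move: xizeta zeta_eta et1 etb.
    move: (expR (- (t + 1))) (expR (- (t + b))) (expR (- t)) => u1 u2 u3.
    by move: (dvis _ _ _) (dvis _ _ _) (dvis _ _ _) => *; lra.
  pose q := (idx j * M + code (idx j) (x j))%N.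
  exists q; last by apply: (hp q).2 => //; exists eta, j.
  have jt' : d o (x j) <= t by case/andP : jt.
  have cM := (hcode _).1 _ (codeM _ _ je jt' xi_eta).
  have ia : (idx j < a)%N.
    rewrite ltnS; apply: le_truncn; case/andP : jt => jt1 _.
    by rewrite lerBlDr ltW// -ltrBlDl.
  rewrite /= /q (@leq_trans (idx j * M + M))// ?ltn_add2l// -mulSnr.
  by rewrite leq_mul2r ia orbT.
have mpsi w' : measurable (psi (dvis o) X w' : set (borel_boundary o xi0)).
  exact: borel_psi.
have := content_subadditive mu (fun q _ => mpsi (p q, t + b - 2)) (mpsi (xi, t + 1)) cover.
have Oxi : Omega X t0 (xi, t + 1) by split => //=; lra.
have [lower _] := andP (pl _ _ Oxi).
move=> /(le_trans lower).
have upper q : (mu (psi (dvis o) X (p q, (t + b - 2)%R)) <=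
    (c2 * expR (- (tau * (t + b - 2))))%:E)%E.
  have Oq : Omega X t0 (p q, t + b - 2) by split; [exact: (hp q).1|move=> /=; lra].
  by have [_] := andP (pl _ _ Oq).
move=> total; have {total} : ((c1 * expR (- (tau * (t + 1))))%:E <=
    \sum_(q < a * M) (c2 * expR (- (tau * (t + b - 2))))%:E)%E.
  by apply: (le_trans total); apply: lee_sum => q _; exact: upper.
rewrite sumEFin sumr_const card_ord lee_fin leNgt => /negP; apply.
apply: le_lt_trans (hbs b t bsb); rewrite -(mulr_natl (c2 * _)) natrM.
apply: ler_wpM2r; first by rewrite mulr_ge0 ?expR_ge0// ltW.
by apply: ler_wpM2r => //; rewrite /a -natr1 lerD2r truncn_le.
Qed.

End PowerLawDiffuse.

Theorem theorem3p11 (R : realType) :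
  exists tmin : R,
  forall (Z : metricType R) (o : Z) (delta0 : R),
  proper_space Z -> cat_minus_one Z ->
  0 < delta0 -> hyperbolicity_constant Z delta0 ->
  (forall (t0 : R) (X : set (boundary Z)) (C : nat -> set Z),
     0 < t0 -> tmin <= t0 ->
     dist_closed (dvis o) X -> admissible o t0 C ->
     ((disjoint_horoballs C \/
       (embedded_convex_sets delta0 C /\ forall m, geodesic_line (C m))) ->
      (exists2 beta : R, 0 < beta &
         diffuse (dvis o) X t0 beta point_sets) ->
      absolute_winning (dvis o) X t0 point_sets
        (Bad (dvis o) X (convex_family o C))) /\
     ((disjoint_horoballs C \/ embedded_convex_sets delta0 C) ->
      (exists2 bstar : R, 0 < bstar &
         diffuse (dvis o) X t0 bstar (range (fun m => boundary_of (C m)))) ->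
      absolute_winning (dvis o) X t0 (range (fun m => boundary_of (C m)))
        (Bad (dvis o) X (convex_family o C)) /\
      schmidt_winning (dvis o) X t0
        (Bad (dvis o) X (convex_family o C)))) /\
  (forall n : nat, is_hyperbolic_space Z n.+1 ->
   forall (nstar : nat) (Lstar tau tau0 c1 c2 : R),
   0 <= Lstar -> 0 < tau -> 0 < tau0 -> 0 < c1 -> 0 < c2 ->
   exists2 bstar : R, 0 < bstar &
   forall (t0 : R) (X : set (boundary Z)) (x : nat -> Z),
     0 < t0 -> tmin <= t0 ->
     dist_closed (dvis o) X -> admissible o t0 (fun m => [set x m]) ->
     separated_points tau0 x ->
   forall (xi0 : boundary Z)
          (mu : {measure set (borel_boundary o xi0) -> \bar R}),
     locally_finite (dvis o) mu -> X = measure_support (dvis o) mu ->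
     power_law (dvis o) X t0 mu c1 c2 tau ->
     family_diffuse (dvis o) X t0 bstar nstar Lstar (point_family o x)).
Proof.
(* The threshold 0 suffices because a late activation of obstacles is absorbed by the constant [c]
   of [Bad], and [t0 > 0] already keeps [o] away from the [x m]. *)
exists 0 => Z o delta0 proper cat delta0_gt0 hyp; split.
- move=> t0 X C _ _ cX [cC _ _]; split.
  + exact: convex_absolute_points.
  + exact: convex_winning_boundaries.
- move=> n hZ nstar Lstar tau tau0 c1 c2 L0 tau_gt0 tau00 c10 c20.
  have [bs bs0 h] := power_law_family_diffuse o cat hyp proper hZ nstar L0 tau_gt0 tau00 c10 c20.
  exists bs => // t0 X x t00 _ cX [_ far _] sep xi0 mu _ _ pl.
  apply: (h _ _ _ t00 cX _ sep _ _ pl) => m.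
  by rewrite -dist_to1; exact: far.
Qed.
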